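(* Let $\mathbf h_{\frac12}=\{h_j\}_{j\ge0}$ be the Haar system in the hyperfinite $\mathrm{II}_1$ factor $\mathcal R_{\frac12}$, and let $\mathbf e$ be the system of matrix units of $B(\ell^2)$ in the shell enumeration. Then the system $\mathbf x=\mathbf h_{\frac12}\otimes\mathbf e$, taken in the shell enumeration, is a Schauder basis of the predual of the hyperfinite factor of type $\mathrm{II}_\infty$, realized as $\mathcal R_{\frac12}\bar\otimes B(\ell^2)$; here an element $h\otimes e$ of the system is identified with the normal functional $(\rho_{\frac12}\otimes\mathrm{Tr})(\,\cdot\,(h\otimes e))$.
   Context: For $\nu\ge1$ let $\mathcal N_\nu$ be the algebra of complex $2^\nu\times2^\nu$ matrices with unit $\mathbf 1_\nu$, with $\mathcal N_\nu\otimes\mathcal N_\mu=\mathcal N_{\nu+\mu}$ via the Kronecker product; $\rho_\nu(x)=2^{-\nu}\mathrm{Tr}(x)$; $i_\nu:\mathcal N_\nu\to\mathcal N_{\nu+1}$, $i_\nu(x)=x\otimes\mathbf 1_1$. $\mathcal R_{\frac12}$ is the von Neumann algebra generated by the GNS representation of the $C^*$-inductive limit of $(\mathcal N_\nu,i_\nu)$ with respect to the tracial state $\rho_{\frac12}$ induced by the $\rho_\nu$; it is the hyperfinite $\mathrm{II}_1$ factor, with canonical embeddings $\pi_\nu:\mathcal N_\nu\to\mathcal R_{\frac12}$. The hyperfinite $\mathrm{II}_\infty$ factor is $\mathcal R_{\frac12}\bar\otimes B(\ell^2)$. Shell enumeration: a pair $(a,b)$, $a,b\ge1$, gets the number $s(a,b)=(b-1)^2+a$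 if $a\le b$ and $s(a,b)=a^2-b+1$ if $a>b$. Matrix units of $\mathcal N_\nu$: $\{e^{(\nu)}_m\}_{0\le m<4^\nu}$, where the matrix unit with entry $1$ in row $a$, column $b$ gets index $m=s(a,b)-1$. Likewise the matrix units of $B(\ell^2)$ (with respect to the standard basis), with row $a$ and column $b$, $a,b\ge1$, are numbered by $s(a,b)$. Haar system $\mathbf h_{\frac12}$: put $$r_0=\mathbf 1_1,\quad r_1=\begin{pmatrix}1&0\\0&-1\end{pmatrix},\quad r_2=\begin{pmatrix}0&1\\1&0\end{pmatrix},\quad r_3=\begin{pmatrix}0&-1\\1&0\end{pmatrix}.$$ Let $\mathbf h_1=\{r_0,r_1,r_2,r_3\}$ and, inductively, for $j=4^\nu q+k$ with $0\le q\le3$, $0\le k<4^\nu$, $h^{(\nu+1)}_j=i_\nu(h^{(\nu)}_k)(\mathbf 1_\nu\otimes r_0)$ if $q=0$ and $h^{(\nu+1)}_j=i_\nu(e^{(\nu)}_k)(\mathbf 1_\nu\otimes r_q)$ if $q\ne0$. Since $r_0=\mathbf 1_1$, $h^{(\nu+1)}_j=i_\nu(h^{(\nu)}_j)$ for $j<4^\nu$, and $h_j:=\pi_\nu(h^{(\nu)}_j)$ for any $\nu$ with $j<4^\nu$. For two sequences $\{x_j\}_{j\ge1}$, $\{y_k\}_{k\ge1}$, the product system $\{x_j\otimes y_k\}$ in the shell enumeration is the sequence in which $x_j\otimes y_k$ has number $s(j,k)$ (the Haar system is re-indexed to start at $1$, preserving order). *)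

(* Defs.v *)
From HB Require Import structures.
From mathcomp Require Import all_boot all_order all_algebra.
From mathcomp Require Import complex mxtens.
From mathcomp Require Import all_classical all_reals all_analysis.
From mathcomp Require Import zify.

Set Implicit Arguments.
Unset Strict Implicit.
Unset Printing Implicit Defensive.

Import Order.TTheory GRing.Theory Num.Theory numFieldNormedType.Exports.
Local Open Scope classical_set_scope.
Local Open Scope ring_scope.

(* Scalars are K = R[i] in the end. The norms of MathComp-Analysis take their
   values in the scalar field, so `|x| is a nonnegative element of R[i], and
   limits of scalars are taken in K^o, the normed module K over itself. *)

HB.mixin Record isHilbert (K : numClosedFieldType) V
    of CompleteNormedModule K V := {
  dot : V -> V -> K ;
  dot_linearl : forall (a : K) (x y z : V),
    dot (a *: x + y) z = a * dot x z + dot y z ;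
  dot_conj : forall x y : V, dot x y = (dot y x)^* ;
  dot_norm : forall x : V, dot x x = `|x| ^+ 2
}.

#[short(type="hilbertType")]
HB.structure Definition Hilbert (K : numClosedFieldType) :=
  { V of isHilbert K V & CompleteNormedModule K V }.

(* The product is a field of the structure, since the library has no structure
   of normed algebras. *)
HB.mixin Record isCStarAlgebra (K : numClosedFieldType) V
    of CompleteNormedModule K V := {
  cone : V ;
  cmul : V -> V -> V ;
  star : V -> V ;
  cone_neq0 : cone != 0 ;
  cmulA : associative cmul ;
  cmul1x : left_id cone cmul ;
  cmulx1 : right_id cone cmul ;
  cmul_linearl : forall (a : K) (x y z : V),
    cmul (a *: x + y) z = a *: cmul x z + cmul y z ;
  cmul_linearr : forall (a : K) (x y z : V),
    cmul z (a *: x + y) = a *: cmul z x + cmul z y ;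
  star_antilinear : forall (a : K) (x y : V),
    star (a *: x + y) = a^* *: star x + star y ;
  star_cmul : forall x y : V, star (cmul x y) = cmul (star y) (star x) ;
  starK : involutive star ;
  norm_cmul : forall x y : V, `|cmul x y| <= `|x| * `|y| ;
  cstar_identity : forall x : V, `|cmul (star x) x| = `|x| ^+ 2
}.

#[short(type="cstarType")]
HB.structure Definition CStarAlgebra (K : numClosedFieldType) :=
  { V of isCStarAlgebra K V & CompleteNormedModule K V }.

Section Shell.

Definition shell (a b : nat) : nat :=
  if (a <= b)%N then ((b - 1) ^ 2 + a)%N else (a ^ 2 - b + 1)%N.

(* The pair (a, b), a, b >= 1, with number n >= 1: see shellK and unshellK. *)
Definition unshell (n : nat) : nat * nat :=
  head (1%N, 1%N)
    [seq p <- [seq (a, b) | a <- iota 1 n, b <- iota 1 n]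
       | shell p.1 p.2 == n].

Definition shell_enum (T : Type) (f : nat -> nat -> T) (n : nat) : T :=
  f (unshell n).1 (unshell n).2.

Lemma shell_bounds a b : (0 < a)%N -> (0 < b)%N ->
  ((maxn a b).-1 ^ 2 < shell a b)%N /\ (shell a b <= maxn a b ^ 2)%N.
Proof.
case: a b => [//|a] [//|b] _ _; rewrite /shell.
case: (leqP a.+1 b.+1) => ab; rewrite ?subn1 /= -!mulnn !mulSn !mulnS; nia.
Qed.

Lemma shell_inj a b c d : (0 < a)%N -> (0 < b)%N -> (0 < c)%N -> (0 < d)%N ->
  shell a b = shell c d -> (a, b) = (c, d).
Proof.
move=> a0 b0 c0 d0 e.
have [h1 h2] := shell_bounds a0 b0; have [h3 h4] := shell_bounds c0 d0.
have m : maxn a b = maxn c d.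
  rewrite e in h1 h2; have := leq_trans h1 h4; have := leq_trans h3 h2.
  by rewrite !ltn_exp2r//; lia.
move: e {h1 h2 h3 h4}; rewrite /shell.
case: a b c d a0 b0 c0 d0 m => [//|a] [//|b] [//|c] [//|d] _ _ _ _.
move=> m; case: (leqP a.+1 b.+1) => ab; case: (leqP c.+1 d.+1) => cd;
  rewrite ?subn1 /= -?mulnn.
- have <- : b = d by lia.
  by move=> e; suff -> : a = c by []; lia.
- have <- : b = c by lia.
  by rewrite !mulSn !mulnS => e; exfalso; nia.
- have <- : a = d by lia.
  by rewrite !mulSn !mulnS => e; exfalso; nia.
- have E : a = c by lia.
  rewrite -E !mulSn !mulnS in cd * => e.
  by suff -> : b = d by []; nia.
Qed.

Lemma shell_ge a b : (0 < a)%N -> (0 < b)%N ->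
  (a <= shell a b)%N /\ (b <= shell a b)%N.
Proof.
move=> a0 b0; have [h _] := shell_bounds a0 b0.
by move: h; rewrite -mulnn; nia.
Qed.

Lemma shellK a b : (0 < a)%N -> (0 < b)%N -> unshell (shell a b) = (a, b).
Proof.
move=> a0 b0; rewrite /unshell; set s := [seq _ | a <- _, b <- _].
have [ha hb] := shell_ge a0 b0.
have : (a, b) \in [seq p <- s | shell p.1 p.2 == shell a b].
  rewrite mem_filter eqxx /=; apply/allpairsP; exists (a, b).
  by rewrite !mem_iota/=; split => //; lia.
case E : [seq p <- s | _] => [//|p r] _ /=.
have : p \in [seq p <- s | shell p.1 p.2 == shell a b] by rewrite E mem_head.
rewrite mem_filter => /andP[/eqP e] /allpairsP[[c d]]/=.
rewrite !mem_iota => -[/andP[c0 _] /andP[d0 _] pE].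
by rewrite pE in e *; apply: shell_inj.
Qed.

Lemma unshellK n : (0 < n)%N ->
  [/\ (0 < (unshell n).1)%N, (0 < (unshell n).2)%N &
      shell (unshell n).1 (unshell n).2 = n].
Proof.
move=> n0.
suff [a [b [a0 b0 <-]]] : exists a b, [/\ 0 < a, 0 < b & shell a b = n]%N.
  by rewrite shellK.
elim: n n0 => // -[|n] IH _; first by exists 1%N, 1%N.
have [//|a' [b' [a0 b0 E]]] := IH.
case: a' b' a0 b0 E => [//|a] [//|b] _ _ E {IH}.
have [ab|ab] := ltnP a b.
  exists a.+2, b.+1; split => //; move: E; rewrite /shell.
  have -> : (a.+1 <= b.+1)%N by lia.
  by have -> : (a.+2 <= b.+1)%N; lia.
case: b ab E => [|b] ab E.
  exists 1%N, a.+2; split => //; move: E; rewrite /shell.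
  have -> : (1 <= a.+2)%N by [].
  by case: a ab => [|a] ab //=; rewrite -!mulnn !mulSn !mulnS; lia.
exists a.+1, b.+1; split => //; move: E; rewrite /shell.
have -> : (a.+1 <= b.+1)%N = false by lia.
have : (b.+2 * b.+2 <= a.+1 * a.+1)%N by rewrite leq_mul.
case: (leqP a.+1 b.+2) => ab'.
  have -> : a = b.+1 by lia.
  by rewrite subn1 -!mulnn !mulSn !mulnS; lia.
by rewrite -!mulnn; nia.
Qed.

End Shell.

Section MatrixTower.
Variable K : numClosedFieldType.

Notation N nu := 'M[K]_(2 ^ nu).

Definition kron nu (x : N nu) (y : N 1) : N nu.+1 :=
  castmx (esym (expnSr 2 nu), esym (expnSr 2 nu)) (tensmx x y).

Definition incl nu (x : N nu) : N nu.+1 := kron x 1%:M.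

Definition adjmx n (x : 'M[K]_n) : 'M[K]_n := map_mx Num.conj x^T.

Definition ntrace nu (x : N nu) : K := (2 ^ nu)%:R^-1 * \tr x.

Definition munit nu (m : nat) : N nu :=
  \matrix_(a, b) ((shell a.+1 b.+1 == m.+1)%:R).

Definition mx2 (a b c d : K) : N 1 :=
  \matrix_(i, j) (if val i == 0%N then (if val j == 0%N then a else b)
                  else (if val j == 0%N then c else d)).

Definition rmx (q : nat) : N 1 :=
  match q with
  | 0 => mx2 1 0 0 1
  | 1 => mx2 1 0 0 (-1)
  | 2 => mx2 0 1 1 0
  | _ => mx2 0 (-1) 1 0
  end.

(* haar nu j is h_j^(nu), for nu >= 1 and j < 4 ^ nu. *)
Fixpoint haar (nu : nat) : nat -> N nu :=
  match nu with
  | 0 => fun=> 0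
  | mu.+1 =>
      match mu return (nat -> N mu) -> nat -> N mu.+1 with
      | 0 => fun _ j => rmx j
      | mu'.+1 => fun h j =>
          let q := (j %/ 4 ^ mu'.+1)%N in
          let k := (j %% 4 ^ mu'.+1)%N in
          incl (if q == 0%N then h k else munit mu'.+1 k) *m kron 1%:M (rmx q)
      end (haar mu)
  end.

Lemma tensmx11 m n : tensmx (1%:M : 'M[K]_m) (1%:M : 'M[K]_n) = 1%:M.
Proof.
apply/matrixP => i j; rewrite -(mxtens_unindexK i) -(mxtens_unindexK j).
case: (mxtens_unindex i) => a b; case: (mxtens_unindex j) => c d.
rewrite tensmxE !mxE -natrM mulnb (can_eq (@mxtens_indexK _ _)).
by rewrite -pair_eqE.
Qed.

Lemma rmx0 : rmx 0 = 1%:M.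
Proof.
apply/matrixP => i j; rewrite !mxE -val_eqE /=.
by case: i j => [[|[|i]] //] ? [[|[|j]] //].
Qed.

(* Hence the element h_j of the limit does not depend on the level nu. *)
Lemma haar_incl nu j : (0 < nu)%N -> (j < 4 ^ nu)%N ->
  haar nu.+1 j = incl (haar nu j).
Proof.
case: nu => // nu _ jn.
rewrite /haar -/haar divn_small// modn_small// eqxx rmx0.
rewrite /kron tensmx11; move: (esym (expnSr 2 nu.+1)) => e.
suff -> : castmx (e, e) (1%:M : 'M[K]_(2 ^ nu.+1 * 2 ^ 1)) = 1%:M.
  by rewrite mulmx1.
by apply/matrixP => x y; rewrite castmxE !mxE -!val_eqE.
Qed.

End MatrixTower.

Section Operators.
Variable K : numClosedFieldType.

Definition span (V : lmodType K) (S : set V) : set V :=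
  [set v | exists n (c : 'I_n -> K) (s : 'I_n -> V),
     (forall i, S (s i)) /\ v = \sum_i c i *: s i].

Definition bounded_op (H : hilbertType K) (T : H -> H) : Prop :=
  linear T /\ exists B : K, forall v, `|T v| <= B * `|v|.

Definition Bop (H : hilbertType K) : set (H -> H) := [set T | bounded_op T].

Definition commutant (H : hilbertType K) (S : set (H -> H)) : set (H -> H) :=
  [set T | bounded_op T /\ forall U, S U -> T \o U = U \o T].

(* Used only for sets S that are closed under adjoints. *)
Definition vN_generated (H : hilbertType K) (S : set (H -> H)) :
  set (H -> H) := commutant (commutant S).

(* (A, j) is the C*-inductive limit of (N_nu, i_nu), nu >= 1. *)
Record is_cstar_limit (A : cstarType K)
    (j : forall nu, 'M[K]_(2 ^ nu) -> A) : Prop := {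
  limit_linear : forall nu, (0 < nu)%N -> linear (j nu) ;
  limit_mul : forall nu, (0 < nu)%N ->
    {morph j nu : x y / x *m y >-> cmul x y} ;
  limit_one : forall nu, (0 < nu)%N -> j nu 1%:M = cone ;
  limit_star : forall nu, (0 < nu)%N -> forall x,
    j nu (adjmx x) = star (j nu x) ;
  limit_inj : forall nu, (0 < nu)%N -> injective (j nu) ;
  limit_compat : forall nu, (0 < nu)%N -> forall x,
    j nu.+1 (incl x) = j nu x ;
  limit_dense : dense (\bigcup_(nu in [set nu | (0 < nu)%N]) range (j nu))
}.

Record is_tracial_state (A : cstarType K) (rho : A -> K) : Prop := {
  state_linear : scalar rho ;
  state_pos : forall x, 0 <= rho (cmul (star x) x) ;
  state_one : rho cone = 1 ;
  state_bounded : forall x, `|rho x| <= `|x| ;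
  state_trace : forall x y, rho (cmul x y) = rho (cmul y x)
}.

(* (H, pi, Omega) is the GNS triple of rho, which is unique up to unitary
   equivalence. *)
Record is_GNS (A : cstarType K) (rho : A -> K) (H : hilbertType K)
    (pi : A -> H -> H) (Omega : H) : Prop := {
  GNS_bounded : forall x, bounded_op (pi x) ;
  GNS_linear : forall v, linear (fun x => pi x v) ;
  GNS_mul : forall x y, pi (cmul x y) = pi x \o pi y ;
  GNS_star : forall x v w, dot (pi (star x) v) w = dot v (pi x w) ;
  GNS_cyclic : dense (range (fun x => pi x Omega)) ;
  GNS_state : forall x, dot (pi x Omega) Omega = rho x
}.

Record is_orthonormal_basis (L : hilbertType K) (delta : nat -> L) : Prop := {
  onb_dot : forall m n, dot (delta m) (delta n) = (m == n)%:R ;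
  onb_total : dense (span (range delta))
}.

Record is_hilbert_tensor (H L HL : hilbertType K) (tens : H -> L -> HL) :
    Prop := {
  tens_linearl : forall y, linear (tens^~ y) ;
  tens_linearr : forall x, linear (tens x) ;
  tens_dot : forall x y x' y',
    dot (tens x y) (tens x' y') = dot x x' * dot y y' ;
  tens_total : dense (span [set v | exists x y, v = tens x y])
}.

Section Tensor.
Variables (H L HL : hilbertType K) (tens : H -> L -> HL).

Definition is_optens (a : H -> H) (b : L -> L) (T : HL -> HL) : Prop :=
  bounded_op T /\ forall x y, T (tens x y) = tens (a x) (b y).

(* The operator a (x) b. *)
Definition optens (a : H -> H) (b : L -> L) : HL -> HL :=
  xget (fun=> 0) [set T | is_optens a b T].

Definition vN_tensor (M : set (H -> H)) (N : set (L -> L)) : set (HL -> HL) :=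
  vN_generated [set T | exists a b, [/\ M a, N b & is_optens a b T]].

(* rho (x) Tr, where rho is the vector state of Omega: Tr is the sum of the
   vector functionals of the delta n.  The series is the trace on positive
   operators, and on the trace ideal it is the linear extension. *)
Definition tau (Omega : H) (delta : nat -> L) (T : HL -> HL) : K :=
  limn (series (fun n => dot (T (tens Omega (delta n)))
                             (tens Omega (delta n))) : nat -> K^o).

(* The matrix unit with entry 1 in row a and column b, for a, b >= 1. *)
Definition eop (delta : nat -> L) (a b : nat) : L -> L :=
  fun y => dot y (delta b.-1) *: delta a.-1.

Definition eseq (delta : nat -> L) (k : nat) : L -> L :=
  shell_enum (eop delta) k.

End Tensor.

(* n starts at 0; n < 4 ^ n.+1, and by haar_incl the level is immaterial. *)
Definition haar_op (A : cstarType K) (j : forall nu, 'M[K]_(2 ^ nu) -> A)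
    (H : hilbertType K) (pi : A -> H -> H) (n : nat) : H -> H :=
  pi (j n.+1 (haar K n.+1 n)).

End Operators.

Section Predual.
Variable R : realType.
Local Notation C := R[i].
Variables (H : hilbertType C) (M : set (H -> H)).

Definition square_summable (xi : nat -> H) : Prop :=
  cvgn (series (fun n => `|xi n| ^+ 2) : nat -> C^o).

(* The functionals that define the sigma-weak topology. *)
Definition sw_form (xi eta : nat -> H) (T : H -> H) : C :=
  limn (series (fun n => dot (T (xi n)) (eta n)) : nat -> C^o).

Definition linear_on (phi : set_type M -> C^o) : Prop :=
  forall (a : C) (S T U : set_type M),
    (forall v, val U v = a *: val S v + val T v) ->
    phi U = a * phi S + phi T.

Definition sw_continuous (phi : set_type M -> C^o) : Prop :=
  forall (T0 : set_type M) (e : C), 0 < e ->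
  exists (m : nat) (xi eta : 'I_m -> nat -> H) (d : C),
    [/\ 0 < d,
        forall i, square_summable (xi i) /\ square_summable (eta i) &
        forall T : set_type M,
          (forall i, `|sw_form (xi i) (eta i) (val T)
                       - sw_form (xi i) (eta i) (val T0)| < d) ->
          `|phi T - phi T0| < e].

Definition predual : set (set_type M -> C^o) :=
  [set phi | linear_on phi /\ sw_continuous phi].

Definition predual_norm (phi : set_type M -> C^o) : R :=
  sup [set complex.Re `|phi T| |
        T in [set T : set_type M | forall v, `|val T v| <= `|v|]].

End Predual.

Section SchauderBasis.
Variable R : realType.
Local Notation C := R[i].

(* A Schauder basis of the normed space X, a subspace of V with norm nrm. *)
Definition schauder_basis (V : lmodType C) (X : set V) (nrm : V -> R)
    (x : nat -> V) : Prop :=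
  (forall n, X (x n)) /\
  forall v, X v -> exists! c : nat -> C,
    nrm (v - \sum_(k < n) c k *: x k) @[n --> \oo] --> (0 : R).

End SchauderBasis.

Section Density.
Variable R : realType.
Local Notation C := R[i].
Variables (H L HL : hilbertType C) (tens : H -> L -> HL).
Variables (Omega : H) (delta : nat -> L) (M : set (HL -> HL)).

(* The functional (rho (x) Tr)( . D). *)
Definition density_functional (D : HL -> HL) : set_type M -> C^o :=
  fun T => tau tens Omega delta (val T \o D).

(* The product of two systems of operators, both starting at index 1. *)
Definition product_system (x : nat -> H -> H) (y : nat -> L -> L) :
  nat -> HL -> HL := shell_enum (fun p q => optens tens (x p) (y q)).

End Density.

Arguments Bop {K} H.
Arguments predual {R H} M.
Arguments predual_norm {R H} M.
Arguments density_functional {R H L HL} tens Omega delta M.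

(* Main.v *)
Require Import Defs.
From mathcomp Require Import all_boot all_order all_algebra.
From mathcomp Require Import complex mxtens.
From mathcomp Require Import all_classical all_reals all_analysis.
From mathcomp Require Import zify ring.

(** Let M be an algebra of operators, u_n and w_n vectors, and D_n operators
    of M with <D_k u_i, w_i> = [i = k]. Put P_n T = sum_(i < n) <T u_i, w_i>
    D_i. If the operators T - P_n T are bounded uniformly in n for T in the
    unit ball of M, and if every matrix coefficient <(T - P_n T) x, y> between
    vectors of a dense set vanishes for large n, then the functionals T |-> <T
    u_n, w_n> form a Schauder basis of the predual of M. Indeed an absolutely
    convergent sum of matrix coefficients is approximated, uniformly on
    bounded sets, by finitely many coefficients between vectors of the dense
    set, so it is small on T - P_n T uniformly on the unit ball; a
    sigma-weakly continuous phi is controlled by finitely many such sums, so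
    phi (T - P_n T) is uniformly small, and this is the convergence in norm of
    the expansion of phi with coefficients phi (D_n). Evaluation at D_n gives
    uniqueness. This is [schauder_criterion].

    The functional of h_p (x) e_ab is T |-> <T (h_p Omega (x) delta_a), Omega
    (x) delta_b>. As the Haar system is orthogonal for the trace
    ([haar_orth_basis]), the operators star h_p / rho (star h_p h_p) (x) e_ba
    are dual to the system.

    An element T of the algebra commutes with right multiplications by unitary
    matrices, which span the matrices of each level; hence ([mem_right]) <T (y
    Omega (x) l), w Omega (x) l'> = <T (y w^* Omega (x) l), Omega (x) l'>. So
    the coefficients of T between core vectors, those with matrix entries of
    one level, are finite combinations of the coordinates of T, and they do
    not see T - P_n T for large n.

    There remains the uniform bound. A prefix of the shell enumeration is a
    signed combination of three rectangles ([shell_sum]). Used once for the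
    pairs (p, q) and once for the matrix units e_ab with number q, this
    reduces P_n T to nine boxes p <= P, a <= A, b <= B. To form a box,
    compress T to a block matrix over the matrices of a level nu, apply to
    each entry the prefix of length P of the Haar expansion, and cut out a
    block. The compression is contractive because it is dual to the action of
    T on core vectors ([compress_bound]). Prefixes of the Haar expansion are
    bounded on block matrices independently of P, nu and the number of blocks
    ([block_bound_haar]): beyond level nu, a prefix consists of at most three
    full components along r_0, ..., r_3 and of one component cut to a prefix
    of the matrix units, that is, to three corners. Finally the norm of a
    block matrix over one level bounds the operator that it defines on the
    whole Hilbert space ([block_op_bound]). *)

Set Implicit Arguments.
Unset Strict Implicit.
Unset Printing Implicit Defensive.

Import Order.TTheory GRing.Theory Num.Theory numFieldNormedType.Exports.
Local Open Scope classical_set_scope.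
Local Open Scope ring_scope.
Local Notation incl := Defs.incl.
Local Notation span := Defs.span.

(** * Prefixes of the shell enumeration *)

Section ShellSums.

Lemma unshellS n : (0 < n)%N ->
  unshell n.+1 =
    let: (a, b) := unshell n in
    if (a < b)%N then (a.+1, b) else if b == 1%N then (1%N, a.+1)
    else (a, b.-1).
Proof.
move=> n0; have [a0 b0] := unshellK n0.
case: (unshell n) a0 b0 => /= a b a0 b0 <-.
set p := if _ then _ else _.
suff [p1 p2 e] : [/\ 0 < p.1, 0 < p.2 & shell p.1 p.2 = (shell a b).+1]%N.
  by rewrite -e shellK//; case: (p).
rewrite /p {p}; case: a b a0 b0 => [//|a] [//|b] _ _.
case: ifP => ab /=.
  split => //; rewrite /shell ab (ltnW ab); lia.
case: ifP => [/eqP [->]|b1] /=.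
  split => //; rewrite /shell /=.
  case: a {ab} => [|a] //=; rewrite subn1 /= -!mulnn; nia.
case: b ab b1 => [//|b] ab _; split => //=; rewrite /shell.
have -> : (a.+1 <= b.+1)%N = false by lia.
case: (leqP a.+1 b.+2) => ab'.
  have -> : a = b.+1 by lia.
  by rewrite subn1 -!mulnn; nia.
by rewrite -!mulnn; nia.
Qed.

Definition rect (V : zmodType) (F : nat -> nat -> V) (A B : nat) : V :=
  \sum_(a < A) \sum_(b < B) F a.+1 b.+1.

Lemma rectS1 (V : zmodType) (F : nat -> nat -> V) A B :
  rect F A.+1 B = rect F A B + \sum_(b < B) F A.+1 b.+1.
Proof. by rewrite /rect big_ord_recr. Qed.

Lemma rectS2 (V : zmodType) (F : nat -> nat -> V) A B :
  rect F A B.+1 = rect F A B + \sum_(a < A) F a.+1 B.+1.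
Proof.
by rewrite /rect -big_split; apply: eq_bigr => i _; rewrite big_ord_recr.
Qed.

Lemma rect0l (V : zmodType) (F : nat -> nat -> V) B : rect F 0 B = 0.
Proof. by rewrite /rect big_ord0. Qed.

Definition shell_prefix (V : zmodType) (F : nat -> nat -> V) (p : nat * nat) :=
  if (p.1 <= p.2)%N
  then rect F p.2.-1 p.2.-1 + \sum_(a < p.1) F a.+1 p.2
  else rect F p.1 p.1 - \sum_(b < p.2.-1) F p.1 b.+1.

(** By induction, one step of the enumeration at a time: within a shell the
    prefix is the previous square and part of a column, then the current
    square without part of a row. *)
Lemma shell_sum_prefix (V : zmodType) (F : nat -> nat -> V) n :
  \sum_(i < n.+1) shell_enum F i.+1 = shell_prefix F (unshell n.+1).
Proof.
elim: n => [|n IH].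
  have -> : unshell 1 = (1, 1)%N by rewrite -(@shellK 1 1).
  rewrite big_ord1 /shell_enum -[1%N]/(shell 1 1) shellK//.
  by rewrite /shell_prefix /= rect0l big_ord1 add0r.
rewrite big_ord_recr IH {IH}/= /shell_enum (@unshellS n.+1)//.
have [] := @unshellK n.+1 isT; case: (unshell n.+1) => -[|a] [|b] //= _ _ _.
rewrite /shell_prefix.
have [ab|ab] := ltnP a b.
  have ab' : (a.+1 < b.+1)%N by [].
  by rewrite ab' (ltnW ab') /= ab' [in RHS]big_ord_recr addrA.
have ab' : (a.+1 < b.+1)%N = false by lia.
rewrite ab' /=; case: b ab ab' => [|b] ab ab' /=.
  rewrite big_ord1; case: ltnP => [|//] a0.
    have -> : a = 0%N by lia.
    by rewrite rect0l big_ord1 add0r /rect !big_ord1.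
  by rewrite big_ord0 subr0.
have -> : (a < b.+1)%N = false by lia.
rewrite /=; case: (ltngtP b.+1 a) ab {ab'} => // [ab|ba] _.
  have -> : (a < b.+2)%N = false by lia.
  by rewrite big_ord_recr/= opprD addrA subrK.
rewrite -ba ltnSn (rectS1 F b.+1 b.+2) (rectS2 F b.+1 b.+1).
rewrite [X in _ + X + _ = _]big_ord_recr/= -!addrA; congr (_ + (_ + _)).
by rewrite !big_ord_recr/= [RHS]addrC !addrA addNr add0r addrC.
Qed.

(** The rectangles depend on the length only, not on the summand: the same
    ones serve for all the vectors at which an operator is evaluated. *)
Lemma shell_sum n : exists A B C A' B' C',
  forall (V : zmodType) (F : nat -> nat -> V), \sum_(i < n) shell_enum F i.+1 =
    rect F A A' + rect F B B' - rect F C C'.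
Proof.
case: n => [|n].
  exists 0%N, 0%N, 0%N, 0%N, 0%N, 0%N => V F.
  by rewrite big_ord0 !rect0l !addr0 subr0.
suff [A [B [C [A' [B' [C' h]]]]]] : exists A B C A' B' C',
    forall (V : zmodType) (F : nat -> nat -> V), shell_prefix F (unshell n.+1) =
    rect F A A' + rect F B B' - rect F C C'.
  by exists A, B, C, A', B', C' => V F; rewrite shell_sum_prefix h.
have [] := @unshellK n.+1 isT; case: (unshell n.+1) => -[|a] [|b] //= _ _ _.
have [ab|ab] := leqP a.+1 b.+1.
  exists b, a.+1, a.+1, b, b.+1, b => V F.
  by rewrite /shell_prefix ab rectS2 -addrA [_ - _]addrC addKr.
exists a.+1, a, a.+1, a.+1, b, b => V F.
by rewrite /shell_prefix leqNgt ab/= (rectS1 F a b) opprD addrA addrK.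
Qed.

(** This is how the matrix units of one level are summed over all entries. *)
Lemma shell_sum_square (V : zmodType) (F : nat -> nat -> V) m :
  \sum_(i < m ^ 2) shell_enum F i.+1 = rect F m m.
Proof.
case: m => [|m]; first by rewrite big_ord0 rect0l.
have e : unshell (m.+1 ^ 2) = (m.+1, 1)%N.
  by rewrite -(@shellK m.+1 1)// /shell; case: m => // m; congr unshell; lia.
have [k ek] : exists k, (m.+1 ^ 2 = k.+1)%N by exists (m.+1 ^ 2).-1; lia.
rewrite ek shell_sum_prefix -ek e /shell_prefix /=; case: m {e ek k} => [|m] /=.
  by rewrite rect0l add0r /rect !big_ord1.
by rewrite big_ord0 subr0.
Qed.
End ShellSums.

(** * The inner product of the trace *)

Section Adjoint.
Variable K : numClosedFieldType.

Lemma adjmxE n (x : 'M[K]_n) i j : adjmx x i j = (x j i)^*.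
Proof. by rewrite !mxE. Qed.

Lemma adjmxK n : involutive (@adjmx K n).
Proof. by move=> x; apply/matrixP => i j; rewrite !adjmxE conjCK. Qed.

Lemma adjmxM n (x y : 'M[K]_n) : adjmx (x *m y) = adjmx y *m adjmx x.
Proof. by rewrite /adjmx trmx_mul map_mxM. Qed.

Lemma adjmx1 n : adjmx (1%:M : 'M[K]_n) = 1%:M.
Proof. by rewrite /adjmx trmx1 map_mx1. Qed.

Lemma adjmxD n (x y : 'M[K]_n) : adjmx (x + y) = adjmx x + adjmx y.
Proof. by rewrite /adjmx linearD map_mxD. Qed.

Lemma adjmx0 n : adjmx (0 : 'M[K]_n) = 0.
Proof. by rewrite /adjmx trmx0 map_mx0. Qed.

Lemma adjmxZ n a (x : 'M[K]_n) : adjmx (a *: x) = a^* *: adjmx x.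
Proof. by rewrite /adjmx linearZ map_mxZ. Qed.

Lemma adjmx_sum n I (r : seq I) (P : pred I) (F : I -> 'M[K]_n) :
  adjmx (\sum_(i <- r | P i) F i) = \sum_(i <- r | P i) adjmx (F i).
Proof. by apply: (big_morph _ (@adjmxD n) (adjmx0 n)). Qed.

Lemma ntraceD nu (x y : 'M[K]_(2 ^ nu)) : ntrace (x + y) = ntrace x + ntrace y.
Proof. by rewrite /ntrace linearD mulrDr. Qed.

Lemma ntraceZ nu a (x : 'M[K]_(2 ^ nu)) : ntrace (a *: x) = a * ntrace x.
Proof. by rewrite /ntrace linearZ mulrCA. Qed.

Lemma ntrace0 nu : ntrace (0 : 'M[K]_(2 ^ nu)) = 0.
Proof. by rewrite /ntrace linear0 mulr0. Qed.

Lemma ntrace_sum nu I (r : seq I) (P : pred I) (F : I -> 'M[K]_(2 ^ nu)) :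
  ntrace (\sum_(i <- r | P i) F i) = \sum_(i <- r | P i) ntrace (F i).
Proof. by apply: (big_morph _ (@ntraceD nu) (ntrace0 nu)). Qed.

Lemma ntraceC nu (x y : 'M[K]_(2 ^ nu)) : ntrace (x *m y) = ntrace (y *m x).
Proof. by rewrite /ntrace mxtrace_mulC. Qed.

(** This is also the inner product of the cyclic representation, on the
    vectors that come from matrices of one level; see [dot_vH]. *)
Definition hs nu (x y : 'M[K]_(2 ^ nu)) : K := ntrace (adjmx y *m x).

Lemma hsDl nu (x y z : 'M[K]_(2 ^ nu)) : hs (x + y) z = hs x z + hs y z.
Proof. by rewrite /hs mulmxDr ntraceD. Qed.

Lemma hsDr nu (x y z : 'M[K]_(2 ^ nu)) : hs z (x + y) = hs z x + hs z y.
Proof. by rewrite /hs adjmxD mulmxDl ntraceD. Qed.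

Lemma hs0l nu (z : 'M[K]_(2 ^ nu)) : hs 0 z = 0.
Proof. by rewrite /hs mulmx0 ntrace0. Qed.

Lemma hs0r nu (z : 'M[K]_(2 ^ nu)) : hs z 0 = 0.
Proof. by rewrite /hs adjmx0 mul0mx ntrace0. Qed.

Lemma hsZl nu a (x z : 'M[K]_(2 ^ nu)) : hs (a *: x) z = a * hs x z.
Proof. by rewrite /hs -scalemxAr ntraceZ. Qed.

Lemma hsZr nu a (x z : 'M[K]_(2 ^ nu)) : hs z (a *: x) = a^* * hs z x.
Proof. by rewrite /hs adjmxZ -scalemxAl ntraceZ. Qed.

Lemma hs_suml nu I (r : seq I) (P : pred I) (F : I -> 'M[K]_(2 ^ nu)) z :
  hs (\sum_(i <- r | P i) F i) z = \sum_(i <- r | P i) hs (F i) z.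
Proof. by apply: (big_morph (fun x => hs x z)) => [x y|]; rewrite ?hsDl ?hs0l. Qed.

Lemma hs_sumr nu I (r : seq I) (P : pred I) (F : I -> 'M[K]_(2 ^ nu)) z :
  hs z (\sum_(i <- r | P i) F i) = \sum_(i <- r | P i) hs z (F i).
Proof. by apply: (big_morph (hs z)) => [x y|]; rewrite ?hsDr ?hs0r. Qed.

Lemma hsE nu (x y : 'M[K]_(2 ^ nu)) :
  hs x y = (2 ^ nu)%:R^-1 * \sum_i \sum_k x i k * (y i k)^*.
Proof.
rewrite /hs /ntrace /mxtrace exchange_big; congr (_ * _).
apply: eq_bigr => k _; rewrite mxE; apply: eq_bigr => i _.
by rewrite adjmxE mulrC.
Qed.

Lemma hs_ge0 nu (x : 'M[K]_(2 ^ nu)) : 0 <= hs x x.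
Proof.
rewrite hsE mulr_ge0 ?invr_ge0 ?ler0n// sumr_ge0// => i _.
by rewrite sumr_ge0// => k _; apply: mul_conjC_ge0.
Qed.

Lemma hs_eq0 nu (x : 'M[K]_(2 ^ nu)) : hs x x = 0 -> x = 0.
Proof.
move=> /eqP; rewrite hsE mulf_eq0 invr_eq0 pnatr_eq0 expn_eq0/= => /eqP h.
apply/matrixP => i k; rewrite mxE; apply/eqP; rewrite -mul_conjC_eq0.
have h' : forall i, 0 <= \sum_k x i k * (x i k)^*.
  by move=> i'; rewrite sumr_ge0// => k' _; apply: mul_conjC_ge0.
have := psumr_eq0P (fun i _ => h' i) h => /(_ i isT) hi.
have := psumr_eq0P (fun k _ => mul_conjC_ge0 (x i k)) hi.
by move=> /(_ k isT) ->.
Qed.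

Lemma hsMl nu (a x y : 'M[K]_(2 ^ nu)) : hs (a *m x) y = hs x (adjmx a *m y).
Proof. by rewrite /hs adjmxM adjmxK mulmxA. Qed.

Lemma hsMr nu (a x y : 'M[K]_(2 ^ nu)) : hs (x *m a) y = hs x (y *m adjmx a).
Proof. by rewrite /hs adjmxM adjmxK mulmxA ntraceC mulmxA. Qed.

Lemma hs_nondeg nu (x y : 'M[K]_(2 ^ nu)) : (forall z, hs x z = hs y z) -> x = y.
Proof.
move=> h; apply/eqP; rewrite -subr_eq0; apply/eqP/hs_eq0.
have -> z : hs (x - y) z = hs (x + (-1) *: y) z by rewrite scaleN1r.
by rewrite hsDl hsZl h mulN1r subrr.
Qed.

End Adjoint.

(** * Tensoring with two-by-two matrices *)

Section Kronecker.
Variable K : numClosedFieldType.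

(** The row of a Kronecker product that comes from row i of the first factor
    and row s of the second. *)
Definition kidx nu (i : 'I_(2 ^ nu)) (s : 'I_(2 ^ 1)) : 'I_(2 ^ nu.+1) :=
  cast_ord (esym (expnSr 2 nu)) (mxtens_index (i, s)).

Lemma kronE nu (x : 'M[K]_(2 ^ nu)) (y : 'M[K]_(2 ^ 1)) i s k t :
  kron x y (kidx i s) (kidx k t) = x i k * y s t.
Proof.
rewrite /kron castmxE /kidx !cast_ord_comp !cast_ord_id.
exact: tensmxE.
Qed.

Lemma kidx_surj nu (k : 'I_(2 ^ nu.+1)) : exists i s, k = kidx i s.
Proof.
exists (mxtens_unindex (cast_ord (expnSr 2 nu) k)).1,
  (mxtens_unindex (cast_ord (expnSr 2 nu) k)).2.
by rewrite /kidx -surjective_pairing mxtens_unindexK cast_ord_comp cast_ord_id.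
Qed.

Lemma kidx_inj nu i s k t : @kidx nu i s = kidx k t -> i = k /\ s = t.
Proof. by move=> /cast_ord_inj/(can_inj (@mxtens_indexK _ _)) []. Qed.

Lemma eq_kidx nu (x y : 'M[K]_(2 ^ nu.+1)) :
  (forall i s k t, x (kidx i s) (kidx k t) = y (kidx i s) (kidx k t)) -> x = y.
Proof.
move=> h; apply/matrixP => a b.
by have [i [s ->]] := kidx_surj a; have [k [t ->]] := kidx_surj b.
Qed.

Lemma sum_kidx (V : nmodType) nu (F : 'I_(2 ^ nu.+1) -> V) :
  \sum_k F k = \sum_i \sum_s F (kidx i s).
Proof.
rewrite pair_bigA/= (reindex (fun p : 'I_(2 ^ nu) * 'I_(2 ^ 1) => kidx p.1 p.2)) //=.
exists (fun k => mxtens_unindex (cast_ord (expnSr 2 nu) k)) => [p _|k _].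
  by rewrite /kidx -surjective_pairing cast_ord_comp cast_ord_id mxtens_indexK.
by rewrite /kidx -surjective_pairing mxtens_unindexK cast_ord_comp cast_ord_id.
Qed.

Lemma kron_mul nu (x x' : 'M[K]_(2 ^ nu)) (y y' : 'M[K]_(2 ^ 1)) :
  kron x y *m kron x' y' = kron (x *m x') (y *m y').
Proof.
apply: eq_kidx => i s k t; rewrite kronE !mxE sum_kidx mulr_suml.
apply: eq_bigr => l _; rewrite mulr_sumr; apply: eq_bigr => u _.
by rewrite !kronE mulrACA.
Qed.

Lemma kron_adj nu (x : 'M[K]_(2 ^ nu)) (y : 'M[K]_(2 ^ 1)) :
  adjmx (kron x y) = kron (adjmx x) (adjmx y).
Proof.
by apply: eq_kidx => i s k t; rewrite adjmxE !kronE !adjmxE rmorphM.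
Qed.

Lemma kronDl nu (x x' : 'M[K]_(2 ^ nu)) (y : 'M[K]_(2 ^ 1)) :
  kron (x + x') y = kron x y + kron x' y.
Proof. by apply: eq_kidx => i s k t; rewrite mxE !kronE mxE mulrDl. Qed.

Lemma kronZl nu a (x : 'M[K]_(2 ^ nu)) (y : 'M[K]_(2 ^ 1)) :
  kron (a *: x) y = a *: kron x y.
Proof. by apply: eq_kidx => i s k t; rewrite mxE !kronE mxE mulrA. Qed.

Lemma kron0l nu (y : 'M[K]_(2 ^ 1)) : kron (0 : 'M[K]_(2 ^ nu)) y = 0.
Proof. by rewrite -{1}(scale0r 0) kronZl scale0r. Qed.

Lemma kron_suml nu I (r : seq I) (P : pred I) (F : I -> 'M[K]_(2 ^ nu)) y :
  kron (\sum_(i <- r | P i) F i) y = \sum_(i <- r | P i) kron (F i) y.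
Proof.
by apply: (big_morph (fun x => kron x y)) => [x z|]; rewrite ?kronDl ?kron0l.
Qed.

Lemma kron11 nu : kron (1%:M : 'M[K]_(2 ^ nu)) 1%:M = 1%:M.
Proof.
apply: eq_kidx => i s k t; rewrite kronE !mxE -natrM mulnb; congr (_%:R).
congr nat_of_bool; apply/andP/eqP => [[/eqP -> /eqP ->]//|].
by move=> /kidx_inj[-> ->].
Qed.

Lemma ntrace_kron nu (x : 'M[K]_(2 ^ nu)) (y : 'M[K]_(2 ^ 1)) :
  ntrace (kron x y) = ntrace x * ntrace y.
Proof.
rewrite /ntrace mulrACA -invfM -natrM -expnD addn1; congr (_ * _).
rewrite /mxtrace sum_kidx mulr_suml; apply: eq_bigr => i _.
by rewrite mulr_sumr; apply: eq_bigr => s _; rewrite kronE.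
Qed.

Lemma hs_kron nu (x x' : 'M[K]_(2 ^ nu)) (y y' : 'M[K]_(2 ^ 1)) :
  hs (kron x y) (kron x' y') = hs x x' * hs y y'.
Proof. by rewrite /hs kron_adj kron_mul ntrace_kron. Qed.

Lemma big_I2 (V : nmodType) (F : 'I_(2 ^ 1) -> V) :
  \sum_s F s = F ord0 + F ord_max.
Proof.
rewrite (big_ord_recl 1) big_ord1; congr (F _ + F _).
by apply: val_inj.
Qed.

Lemma rmx_unitary q : rmx K q *m adjmx (rmx K q) = 1%:M.
Proof.
apply/matrixP => i k; rewrite mxE big_I2 !adjmxE !mxE -val_eqE.
case: q => [|[|[|q]]]; rewrite /= !mxE /=;
case: i k => [[|[|i]] //= ?] [[|[|k]] //= ?];
by rewrite ?(rmorphN, rmorph1, rmorph0, mulr0, mul0r, mulr1, mulrN1, opprK, addr0, add0r, oppr0).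
Qed.

Lemma hs_rmx p q : (p < 4)%N -> (q < 4)%N -> hs (rmx K p) (rmx K q) = (p == q)%:R.
Proof.
move=> p4 q4; rewrite hsE !big_I2.
apply: (mulfI (_ : 2%:R != 0 :> K)); rewrite ?pnatr_eq0// mulVKf ?pnatr_eq0//.
case: p p4 => [|[|[|[|p]]]] //; case: q q4 => [|[|[|[|q]]]] // _ _;
by rewrite /= !mxE /= ?(rmorphN, rmorph1, rmorph0); ring.
Qed.

(** Completeness of the four matrices: together with their orthogonality it
    says that they form an orthonormal basis, and it is used to expand a
    matrix along the second tensor factor. *)
Lemma rmx_complete i k i' k' :
  \sum_(q < 4) rmx K q i k * (rmx K q i' k')^* =
    2 * ((i == i') && (k == k'))%:R.
Proof.
rewrite !big_ord_recr big_ord0 /= !mxE /= -!val_eqE /=.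
case: i i' => [[|[|i]] //= ?] [[|[|i']] //= ?];
case: k k' => [[|[|k]] //= ?] [[|[|k']] //= ?];
rewrite ?(rmorphN, rmorph1, rmorph0) /=; ring.
Qed.

End Kronecker.

(** * The Haar system as an orthogonal basis *)

Section HaarBasis.
Variable K : numClosedFieldType.

(** The product of y and 1 (x) adjmx r_q, traced out over the second factor; y
    is the sum of its coordinates tensored with r_q, by [coord_sum]. *)
Definition rmx_coord nu (q : nat) (y : 'M[K]_(2 ^ nu.+1)) : 'M[K]_(2 ^ nu) :=
  \matrix_(i, k) (2^-1 *
     \sum_s \sum_t y (kidx i s) (kidx k t) * (rmx K q s t)^*).

Lemma coord_sum nu (y : 'M[K]_(2 ^ nu.+1)) :
  y = \sum_(q < 4) kron (rmx_coord q y) (rmx K q).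
Proof.
apply: eq_kidx => i s k t; rewrite summxE.
under eq_bigr => q _ do rewrite kronE mxE -mulrA mulr_suml.
rewrite -mulr_sumr exchange_big/=.
under eq_bigr => s' _.
  under eq_bigr => q _ do rewrite mulr_suml.
  rewrite exchange_big/=.
  under eq_bigr => t' _.
    under eq_bigr => q _ do rewrite -mulrA [_^* * _]mulrC.
    rewrite -mulr_sumr rmx_complete.
  over.
over.
rewrite (bigD1 s)//= (bigD1 t)//= !eqxx !big1 ?addr0 => [|s' ss'|t' tt'].
- by rewrite mulr1 mulrCA mulVf ?mulr1// pnatr_eq0.
- by rewrite big1// => t' _; rewrite eq_sym (negPf ss')/= !mulr0.
- by rewrite eq_sym (negPf tt') !mulr0.
Qed.

Lemma hs_coord nu q (y : 'M[K]_(2 ^ nu.+1)) (z : 'M[K]_(2 ^ nu)) : (q < 4)%N ->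
  hs (rmx_coord q y) z = hs y (kron z (rmx K q)).
Proof.
move=> q4; rewrite [in RHS](coord_sum y) hs_suml.
rewrite (bigD1 (Ordinal q4))//= hs_kron hs_rmx// eqxx mulr1.
rewrite big1 ?addr0// => p /negPf pq; rewrite hs_kron hs_rmx//.
by rewrite -[X in (_ == X)]/(val (Ordinal q4)) val_eqE pq mulr0.
Qed.

Lemma hs_coord_sum nu (y z : 'M[K]_(2 ^ nu.+1)) :
  hs y z = \sum_(q < 4) hs (rmx_coord q y) (rmx_coord q z).
Proof.
by rewrite [in LHS](coord_sum z) hs_sumr; apply: eq_bigr => q _; rewrite hs_coord.
Qed.

Lemma coordD nu q (x y : 'M[K]_(2 ^ nu.+1)) :
  rmx_coord q (x + y) = rmx_coord q x + rmx_coord q y.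
Proof.
apply/matrixP => i k; rewrite !mxE -mulrDr -big_split; congr (_ * _).
apply: eq_bigr => s _; rewrite -big_split; apply: eq_bigr => t _.
by rewrite mxE mulrDl.
Qed.

Lemma coord0 nu q : rmx_coord q (0 : 'M[K]_(2 ^ nu.+1)) = 0.
Proof.
apply/matrixP => i k; rewrite !mxE big1 ?mulr0// => s _.
by rewrite big1// => t _; rewrite mxE mul0r.
Qed.

Lemma coord_suml nu q I (r : seq I) (P : pred I) (F : I -> 'M[K]_(2 ^ nu.+1)) :
  rmx_coord q (\sum_(i <- r | P i) F i) = \sum_(i <- r | P i) rmx_coord q (F i).
Proof. by apply: (big_morph (rmx_coord q)) => [x y|]; rewrite ?coordD ?coord0. Qed.

Lemma coord_kron1M nu q (x : 'M[K]_(2 ^ nu)) (y : 'M[K]_(2 ^ nu.+1)) : (q < 4)%N ->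
  rmx_coord q (kron x 1%:M *m y) = x *m rmx_coord q y.
Proof.
move=> q4; apply: hs_nondeg => z.
by rewrite hs_coord// !hsMl kron_adj adjmx1 kron_mul mul1mx hs_coord.
Qed.

(** Completeness is stated as the Fourier expansion, the form in which it is
    used. *)
Definition orth_basis nu (f : nat -> 'M[K]_(2 ^ nu)) : Prop :=
  [/\ forall m n, (m < 4 ^ nu)%N -> (n < 4 ^ nu)%N -> m != n ->
        hs (f m) (f n) = 0,
      forall m, (m < 4 ^ nu)%N -> hs (f m) (f m) != 0 &
      forall y, y = \sum_(m < 4 ^ nu) (hs y (f m) / hs (f m) (f m)) *: f m].

(** Indices start at 1, as in the shell enumeration, and out of range indices
    give 0. *)
Definition unitmx_at nu (a b : nat) : 'M[K]_(2 ^ nu) :=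
  \matrix_(i, k) ((i.+1 == a) && (k.+1 == b))%:R.

Lemma munitE nu m : munit K nu m = shell_enum (@unitmx_at nu) m.+1.
Proof.
apply/matrixP => i k; rewrite /shell_enum !mxE; congr (nat_of_bool _)%:R.
have [a0 b0 e] := @unshellK m.+1 isT.
apply/eqP/andP => [<-|[/eqP -> /eqP ->]//]; by rewrite shellK.
Qed.

Lemma unitmx_at_delta nu (i k : 'I_(2 ^ nu)) : unitmx_at nu i.+1 k.+1 = delta_mx i k.
Proof. by apply/matrixP => a b; rewrite !mxE !eqSS. Qed.

Lemma munit_delta nu m : (m < 4 ^ nu)%N ->
  exists i k : 'I_(2 ^ nu), unshell m.+1 = (i.+1, k.+1) /\ munit K nu m = delta_mx i k.
Proof.
move=> mn; have [a0 b0 e] := @unshellK m.+1 isT.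
have [l u] := shell_bounds a0 b0.
have mx : ((maxn (unshell m.+1).1 (unshell m.+1).2).-1 < 2 ^ nu)%N.
  rewrite -(ltn_exp2r _ _ (_ : 0 < 2)%N)// -expnM mulnC expnM.
  by apply: leq_trans l _; rewrite e.
have [ha hb] : ((unshell m.+1).1.-1 < 2 ^ nu /\ (unshell m.+1).2.-1 < 2 ^ nu)%N.
  by lia.
exists (Ordinal ha), (Ordinal hb); rewrite /= !prednK//.
rewrite -surjective_pairing; split => //.
by rewrite munitE /shell_enum -unitmx_at_delta /= !prednK.
Qed.

Lemma hs_delta nu (x : 'M[K]_(2 ^ nu)) i k :
  hs x (delta_mx i k) = (2 ^ nu)%:R^-1 * x i k.
Proof.
rewrite hsE; congr (_ * _); rewrite (bigD1 i)//= (bigD1 k)//= !mxE !eqxx.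
rewrite conjC1 mulr1 !big1 ?addr0// => [i' /negPf ii'|k' /negPf kk'].
  by apply: big1 => k' _; rewrite mxE ii' conjC0 mulr0.
by rewrite mxE kk' andbF conjC0 mulr0.
Qed.

Lemma pow2_neq0 nu : (2 ^ nu)%:R != 0 :> K.
Proof. by rewrite pnatr_eq0 expn_eq0. Qed.

Lemma munit_orth_basis nu : orth_basis (munit K nu).
Proof.
split.
- move=> m n mn nn; have [i [k [e ->]]] := munit_delta mn.
  have [i' [k' [e' ->]]] := munit_delta nn => mn'.
  rewrite hs_delta mxE; case: eqP => [ii|]; rewrite ?mulr0//=.
  case: eqP => [kk|]; rewrite ?mulr0//=; case/eqP: mn'.
  have [_ _ eM] := @unshellK m.+1 isT; have [_ _ eN] := @unshellK n.+1 isT.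
  by apply/eqP; rewrite -eqSS -eM -eN e e' ii kk.
- move=> m mn; have [i [k [e ->]]] := munit_delta mn.
  by rewrite hs_delta mxE !eqxx mulr1 invr_eq0 pow2_neq0.
- move=> y.
  pose F a b := (hs y (unitmx_at nu a b) / hs (unitmx_at nu a b) (unitmx_at nu a b))
     *: unitmx_at nu a b.
  rewrite [RHS](_ : _ = \sum_(m < (2 ^ nu) ^ 2) shell_enum F m.+1); last first.
    rewrite -(expnM 2) mulnC expnM; apply: eq_bigr => m _.
    by rewrite munitE.
  rewrite shell_sum_square /rect {1}(matrix_sum_delta y).
  apply: eq_bigr => i _; apply: eq_bigr => k _.
  rewrite /F unitmx_at_delta !hs_delta mxE !eqxx mulr1.
  by rewrite mulrAC divff ?mul1r// invr_eq0 pow2_neq0.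
Qed.

(** Level zero is completed by the unit, which makes the recursion
    [haar_basisS] uniform in the level. *)
Definition haar_basis nu (m : nat) : 'M[K]_(2 ^ nu) :=
  if nu == 0%N then 1%:M else haar K nu m.

Definition haar_factor nu q := if q == 0%N then @haar_basis nu else munit K nu.

(** The recursion of the Haar system in one formula: block q consists of the
    r_q components, carried by the previous Haar system for q = 0 and by the
    matrix units otherwise. *)
Lemma haar_basisS nu q k : (k < 4 ^ nu)%N ->
  haar_basis nu.+1 (q * 4 ^ nu + k) = kron (haar_factor nu q k) (rmx K q).
Proof.
move=> kn; case: nu kn => [|nu] kn.
  have -> : k = 0%N by move: kn; rewrite expn0; case: (k).
  rewrite muln1 addn0 [LHS]/(rmx K q); apply: eq_kidx => i s k' t.
  have e (i' : 'I_(2 ^ 0)) s' : kidx i' s' = s'.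
    by apply: val_inj; rewrite /=; case: i' => -[].
  rewrite kronE !e (_ : haar_factor 0 q 0 i k' = 1) ?mul1r//.
  have -> : k' = i by apply: val_inj; case: i k' => -[|//] ? [[]].
  rewrite /haar_factor /haar_basis; case: ifP; rewrite !mxE ?eqxx// => _.
  by case: i => -[].
rewrite /haar_basis /= divnMDl ?expn_gt0// divn_small// addn0.
rewrite modnMDl modn_small// /incl kron_mul mulmx1 mul1mx.
by rewrite /haar_factor /haar_basis; case: q.
Qed.

Lemma pow4S_split nu m : (m < 4 ^ nu.+1)%N ->
  exists q k, [/\ (q < 4)%N, (k < 4 ^ nu)%N & m = q * 4 ^ nu + k]%N.
Proof.
move=> mn; exists (m %/ 4 ^ nu)%N, (m %% 4 ^ nu)%N.
by rewrite -divn_eq ltn_pmod ?expn_gt0// ltn_divLR ?expn_gt0// -expnS.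
Qed.

Lemma sum_pow4S (V : nmodType) nu (F : nat -> V) q :
  \sum_(m < q * 4 ^ nu) F m = \sum_(p < q) \sum_(k < 4 ^ nu) F (p * 4 ^ nu + k)%N.
Proof.
rewrite -(big_mkord xpredT F) big_nat_mul big_mkord; apply: eq_bigr => p _.
rewrite -{1}[(p * _)%N]add0n big_addn mulSn addnK big_mkord.
by apply: eq_bigr => k _; rewrite addnC.
Qed.

(** Orthogonality and completeness pass to the next level because they hold
    for each of the four blocks, and the r_q are orthonormal. *)
Lemma haar_orth_basis nu : orth_basis (@haar_basis nu).
Proof.
elim: nu => [|nu IH].
  have h1 : hs (1%:M : 'M[K]_(2 ^ 0)) 1%:M = 1.
    by rewrite /hs adjmx1 mul1mx /ntrace mxtrace1 mulVf// pow2_neq0.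
  rewrite /haar_basis /=; split => [m n|m _|y]; rewrite ?h1 ?oner_eq0//.
    by case: m => //; case: n.
  rewrite (big_ord_recl 0) big_ord0 addr0 divr1 /hs adjmx1 mul1mx /ntrace.
  rewrite invr1 mul1r {1}[y]mx11_scalar /mxtrace big_ord1.
  by rewrite scalemx1; congr (y _ _)%:M; apply: val_inj.
have B q : orth_basis (haar_factor nu q).
  by rewrite /haar_factor; case: ifP => _; [exact: IH|exact: munit_orth_basis].
have hh q k : (q < 4)%N -> (k < 4 ^ nu)%N -> hs (haar_basis nu.+1 (q * 4 ^ nu + k))
    (haar_basis nu.+1 (q * 4 ^ nu + k)) = hs (haar_factor nu q k) (haar_factor nu q k).
  by move=> q4 kn; rewrite haar_basisS// hs_kron hs_rmx// eqxx mulr1.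
split.
- move=> _ _ /pow4S_split[q [k [q4 kn ->]]] /pow4S_split[q' [k' [q4' kn' ->]]] mn.
  rewrite !haar_basisS// hs_kron hs_rmx//.
  case: eqP => [e|]; rewrite ?mulr0// -e in mn *.
  by have [-> //] := B q; rewrite ?mul0r//; move: mn; rewrite eqn_add2l.
- move=> _ /pow4S_split[q [k [q4 kn ->]]].
  by rewrite hh//; have [_ /(_ k kn)] := B q.
- move=> y; rewrite {1}(coord_sum y) (expnS 4)
    (sum_pow4S _ (fun m => (hs y (haar_basis nu.+1 m) /
      hs (haar_basis nu.+1 m) (haar_basis nu.+1 m)) *: haar_basis nu.+1 m)).
  apply: eq_bigr => q _; have [_ _ e] := B q; rewrite {1}(e (rmx_coord q y)) kron_suml.
  by apply: eq_bigr => k _; rewrite kronZl hh// haar_basisS// hs_coord.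
Qed.

Lemma hs_conj nu (x y : 'M[K]_(2 ^ nu)) : (hs x y)^* = hs y x.
Proof.
rewrite !hsE rmorphM fmorphV rmorph_nat rmorph_sum; congr (_ * _).
apply: eq_bigr => i _; rewrite rmorph_sum; apply: eq_bigr => k _.
by rewrite rmorphM /= conjCK mulrC.
Qed.

(** The expansion is along the adjoints of f, since the pairing of x with f m
    is ntrace (x *m f m), without an adjoint. *)
Definition dual_prefix nu (f : nat -> 'M[K]_(2 ^ nu)) P (x : 'M[K]_(2 ^ nu)) :=
  \sum_(m < P) (ntrace (x *m f m) / hs (f m) (f m)) *: adjmx (f m).

Lemma dual_prefix_full nu f (x : 'M[K]_(2 ^ nu)) : orth_basis f ->
  dual_prefix f (4 ^ nu) x = x.
Proof.
case=> _ _ e; rewrite -[RHS]adjmxK [in RHS](e (adjmx x)) adjmx_sum.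
apply: eq_bigr => m _; rewrite adjmxZ rmorphM fmorphV /= !hs_conj.
by rewrite [hs _ (adjmx x)]/hs adjmxK.
Qed.

Lemma ntrace_coord nu q (x : 'M[K]_(2 ^ nu.+1)) (b : 'M[K]_(2 ^ nu)) : (q < 4)%N ->
  ntrace (x *m kron b (rmx K q)) =
  ntrace (rmx_coord 0 (kron 1%:M (rmx K q) *m x) *m b).
Proof.
move=> q4; have -> : ntrace (rmx_coord 0 (kron 1%:M (rmx K q) *m x) *m b) =
    hs (rmx_coord 0 (kron 1%:M (rmx K q) *m x)) (adjmx b).
  by rewrite /hs adjmxK ntraceC.
rewrite hs_coord// /hs kron_adj adjmxK rmx0 adjmx1 mulmxA kron_mul.
by rewrite mulmx1 mul1mx ntraceC.
Qed.

(** A prefix that ends in block q contains the blocks before q entirely, and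
    there the expansion returns the whole component. *)
Lemma dual_prefixS nu q k (x : 'M[K]_(2 ^ nu.+1)) : (q < 4)%N -> (k <= 4 ^ nu)%N ->
  let W p := rmx_coord 0 (kron 1%:M (rmx K p) *m x) in
  dual_prefix (haar_basis nu.+1) (q * 4 ^ nu + k) x =
    \sum_(p < q) kron (W p) (adjmx (rmx K p)) +
    kron (dual_prefix (haar_factor nu q) k (W q)) (adjmx (rmx K q)).
Proof.
move=> q4 kn W.
have B p : orth_basis (haar_factor nu p).
  rewrite /haar_factor; case: ifP => _; [exact: haar_orth_basis|exact: munit_orth_basis].
have step p l : (p < 4)%N -> (l < 4 ^ nu)%N ->
    let h := haar_basis nu.+1 (p * 4 ^ nu + l) in
    (ntrace (x *m h) / hs h h) *: adjmx h =
    kron ((ntrace (W p *m haar_factor nu p l) / hs (haar_factor nu p l) (haar_factor nu p l))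
      *: adjmx (haar_factor nu p l)) (adjmx (rmx K p)).
  move=> p4 l4 /=; rewrite haar_basisS// ntrace_coord// hs_kron hs_rmx// eqxx mulr1.
  by rewrite kron_adj kronZl.
rewrite {1}/dual_prefix big_split_ord/=; congr (_ + _).
  rewrite (sum_pow4S _ (fun m => (ntrace (x *m haar_basis nu.+1 m) /
    hs (haar_basis nu.+1 m) (haar_basis nu.+1 m)) *: adjmx (haar_basis nu.+1 m))).
  apply: eq_bigr => p _; rewrite -[W p in RHS](dual_prefix_full _ (B p)).
  rewrite kron_suml; apply: eq_bigr => l _.
  by rewrite step// (leq_trans (ltn_ord p)) 1?ltnW.
rewrite kron_suml; apply: eq_bigr => l _.
by rewrite step// (leq_trans (ltn_ord l)).
Qed.

(** The term of e_ab in the expansion of x is e_bb x e_aa, so a rectangle of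
    terms is a compression of x by two diagonal projections. *)
Lemma dual_prefix_corners nu k :
  let p A := \sum_(a < A) @unitmx_at nu a.+1 a.+1 in
  exists A B C A' B' C', forall x : 'M[K]_(2 ^ nu), dual_prefix (munit K nu) k x =
    p A *m x *m p A' + p B *m x *m p B' - p C *m x *m p C'.
Proof.
move=> p; have [A [B [C [A' [B' [C' e]]]]]] := shell_sum k.
exists A', B', C', A, B, C => x.
pose G a b := unitmx_at nu b b *m x *m unitmx_at nu a a.
have GE a b : (0 < a)%N -> (0 < b)%N ->
    (ntrace (x *m unitmx_at nu a b) / hs (unitmx_at nu a b) (unitmx_at nu a b))
      *: adjmx (unitmx_at nu a b) = G a b.
  case: a b => [//|a] [//|b] _ _; rewrite /G.
  have E0 c d : ((2 ^ nu <= c) || (2 ^ nu <= d))%N -> unitmx_at nu c.+1 d.+1 = 0.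
    move=> cd; apply/matrixP => i l; rewrite !mxE !eqSS.
    case: eqP => //= ci; case: eqP => //= dl.
    move: (ltn_ord i) (ltn_ord l); rewrite ci dl !ltnNge.
    by case/orP: cd => ->.
  have [an|an] := ltnP a (2 ^ nu); last first.
    by rewrite (E0 a b) ?an// (E0 a a) ?an// mulmx0 adjmx0 scaler0 mulmx0.
  have [bn|bn] := ltnP b (2 ^ nu); last first.
    by rewrite (E0 a b) ?bn ?orbT// (E0 b b) ?bn// !mul0mx adjmx0 scaler0.
  have -> := unitmx_at_delta (Ordinal an) (Ordinal bn).
  have -> := unitmx_at_delta (Ordinal an) (Ordinal an).
  have -> := unitmx_at_delta (Ordinal bn) (Ordinal bn).
  set i := Ordinal an; set l := Ordinal bn.
  rewrite hs_delta mxE !eqxx mulr1 invrK.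
  have -> : ntrace (x *m delta_mx i l) = (2 ^ nu)%:R^-1 * x l i.
    have ad : adjmx (delta_mx l i : 'M[K]_(2 ^ nu)) = delta_mx i l.
      by apply/matrixP => c d; rewrite adjmxE !mxE conjC_nat andbC.
    by rewrite ntraceC -[delta_mx i l]ad -/(hs x (delta_mx l i)) hs_delta.
  rewrite mulrAC mulVf ?pow2_neq0// mul1r.
  apply/matrixP => c d; rewrite !mxE conjC_nat.
  rewrite (bigD1 i)//= big1 ?addr0 => [|c' /negPf cc']; last first.
    by rewrite !mxE cc' mulr0.
  rewrite mxE (bigD1 l)//= big1 ?addr0 => [|c' /negPf cc']; last first.
    by rewrite !mxE cc' andbF mul0r.
  rewrite !mxE !eqxx andbT /=.
  by case: (c == l); case: (d == i); rewrite ?(mulr1, mulr0, mul1r, mul0r).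
have rG D D' : rect G D D' = p D' *m x *m p D.
  rewrite /rect /G /p mulmx_sumr; apply: eq_bigr => a _.
  by rewrite -!mulmx_suml; congr (_ *m _ *m _).
rewrite -!rG -e; apply: eq_bigr => m _.
have [a0 b0 _] := @unshellK m.+1 isT.
by rewrite /shell_enum munitE /shell_enum GE.
Qed.

End HaarBasis.

(** * Norms of block matrices *)

Section BlockBounds.
Variable K : numClosedFieldType.

(** C bounds the square of the norm of X acting by left multiplication on
    columns of matrices. It is the square, and a natural number, so that no
    square root appears before the passage to operators. *)
Definition block_bound nu n (X : 'I_n -> 'I_n -> 'M[K]_(2 ^ nu)) (C : nat) :=
  forall y : 'I_n -> 'M[K]_(2 ^ nu),
    \sum_d hs (\sum_c X d c *m y c) (\sum_c X d c *m y c) <=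
    C%:R * \sum_c hs (y c) (y c).

Section Level.
Variables (nu n : nat).
Implicit Types X Y : 'I_n -> 'I_n -> 'M[K]_(2 ^ nu).

Lemma block_bound_le X C D : (C <= D)%N -> block_bound X C -> block_bound X D.
Proof.
move=> CD XC y; apply: le_trans (XC y) _; apply: ler_wpM2r; rewrite ?ler_nat//.
by apply: sumr_ge0 => c _; apply: hs_ge0.
Qed.

Lemma block_bound0 C : block_bound (fun _ _ : 'I_n => 0 : 'M[K]_(2 ^ nu)) C.
Proof.
move=> y; rewrite big1 => [|d _].
  by rewrite mulr_ge0 ?ler0n// sumr_ge0// => c _; apply: hs_ge0.
by rewrite big1 ?hs0l// => c _; rewrite mul0mx.
Qed.

Lemma block_bound_eq X Y C : (forall d c, X d c = Y d c) -> block_bound X C ->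
  block_bound Y C.
Proof.
move=> XY XC y; apply: le_trans (XC y); rewrite le_eqVlt; apply/orP; left.
apply/eqP; apply: eq_bigr => d _.
by under [X in hs X _]eq_bigr do rewrite -XY; under [X in hs _ X]eq_bigr do rewrite -XY.
Qed.

Lemma block_boundN X C : block_bound X C -> block_bound (fun d c => - X d c) C.
Proof.
move=> XC y; apply: le_trans (XC y); rewrite le_eqVlt; apply/orP; left.
apply/eqP; apply: eq_bigr => d _.
under eq_bigr do rewrite mulNmx; rewrite sumrN -scaleN1r hsZl hsZr.
by rewrite mulrA rmorphN1 mulrNN mulr1 mul1r.
Qed.

(** Parallelogram inequality; the loss of a factor is harmless since the
    number of summands will be bounded. *)
Lemma block_boundD X Y C D : block_bound X C -> block_bound Y D ->
  block_bound (fun d c => X d c + Y d c) (2 * (C + D)).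
Proof.
move=> XC YD y.
have par (u v : 'M[K]_(2 ^ nu)) : hs (u + v) (u + v) <= 2%:R * (hs u u + hs v v).
  have := hs_ge0 (u + (-1) *: v); rewrite !(hsDl, hsDr, hsZl, hsZr) rmorphN1.
  rewrite -subr_ge0 => h; rewrite -subr_ge0.
  by move: h; congr (0 <= _); ring.
under eq_bigr do (under eq_bigr do rewrite mulmxDl; rewrite big_split).
apply: le_trans (ler_sum _ (fun d _ => par _ _)) _.
rewrite -mulr_sumr big_split /= natrM natrD -mulrA ler_wpM2l ?ler0n//.
by rewrite mulrDl lerD//.
Qed.

Lemma block_bound_sum m (X : 'I_m -> 'I_n -> 'I_n -> 'M[K]_(2 ^ nu)) C :
  (forall i, block_bound (X i) C) ->
  block_bound (fun d c => \sum_i X i d c) (4 ^ m * C).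
Proof.
elim: m X => [|m IH] X XC.
  apply: block_bound_eq (block_bound0 _) => d c; by rewrite big_ord0.
apply: (@block_bound_eq (fun d c => \sum_(i < m) X (widen_ord (leqnSn m) i) d c +
    X ord_max d c)) => [d c|]; first by rewrite big_ord_recr.
apply: block_bound_le (block_boundD (IH _ (fun i => XC _)) (XC ord_max)).
rewrite expnS -mulnA -mulSnr mulnCA.
have : (0 < 4 ^ m)%N by rewrite expn_gt0.
nia.
Qed.

Definition contractive (u : 'M[K]_(2 ^ nu)) := forall z, hs (u *m z) (u *m z) <= hs z z.

Lemma block_bound_mull u X C : contractive u -> block_bound X C ->
  block_bound (fun d c => u *m X d c) C.
Proof.
move=> uc XC y; apply: le_trans (XC y); apply: ler_sum => d _.
by under eq_bigr do rewrite -mulmxA; rewrite -mulmx_sumr.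
Qed.

Lemma block_bound_mulr u X C : contractive u -> block_bound X C ->
  block_bound (fun d c => X d c *m u) C.
Proof.
move=> uc XC y.
under eq_bigr do under eq_bigr do rewrite -mulmxA.
apply: le_trans (XC _) _; rewrite ler_wpM2l ?ler0n//.
by apply: ler_sum => c _.
Qed.

Lemma block_bound_mask (P Q : pred 'I_n) X C : block_bound X C ->
  block_bound (fun d c => if P d && Q c then X d c else 0) C.
Proof.
move=> XC y; pose y' c := if Q c then y c else 0.
have e d : \sum_c (if P d && Q c then X d c else 0) *m y c =
    if P d then \sum_c X d c *m y' c else 0.
  case: (P d) => /=; last by rewrite big1// => c _; rewrite mul0mx.
  by apply: eq_bigr => c _; rewrite /y'; case: (Q c); rewrite ?mul0mx ?mulmx0.
apply: (@le_trans _ _ (C%:R * \sum_c hs (y' c) (y' c))).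
  apply: le_trans (XC y'); apply: ler_sum => d _; rewrite e.
  by case: (P d); rewrite // hs0l hs_ge0.
rewrite ler_wpM2l ?ler0n//; apply: ler_sum => c _; rewrite /y'.
by case: (Q c); rewrite // hs0l hs_ge0.
Qed.

Lemma unitary_contractive u : adjmx u *m u = 1%:M -> contractive u.
Proof. by move=> uu z; rewrite hsMl mulmxA uu mul1mx. Qed.

(** Left multiplication by this diagonal projection deletes rows. *)
Lemma corner_contractive A :
  contractive (\sum_(a < A) @unitmx_at K nu a.+1 a.+1).
Proof.
move=> z; set p := \sum_(a < A) _.
have e i k : (p *m z) i k = if (i < A)%N then z i k else 0.
  have pE l : p i l = ((i < A) && (i == l))%N%:R.
    rewrite /p summxE; under eq_bigr do rewrite mxE !eqSS.
    case: ltnP => iA /=.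
      rewrite (bigD1 (Ordinal iA))//= eqxx big1 ?addr0 => [|a /negPf ai].
        by rewrite eq_sym.
      by rewrite [_ == _ :> nat](_ : _ = (Ordinal iA == a)) // eq_sym ai.
    rewrite big1// => a _; case: eqP => //= ia.
    by move: (ltn_ord a); rewrite -ia ltnNge iA.
  rewrite mxE (bigD1 i)//= pE eqxx andbT big1 ?addr0 => [|l /negPf li].
    by case: ifP; rewrite ?mul1r ?mul0r.
  by rewrite pE eq_sym li andbF mul0r.
rewrite !hsE ler_wpM2l ?invr_ge0 ?ler0n//.
apply: ler_sum => i _; apply: ler_sum => k _; rewrite e.
by case: ifP => // _; rewrite mul0r mul_conjC_ge0.
Qed.

End Level.

(** The partial trace is a compression: X acts on columns y (x) 1, and the
    component of the result along 1 has a smaller norm. *)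
Lemma block_bound_coord0 nu n (X : 'I_n -> 'I_n -> 'M[K]_(2 ^ nu.+1)) C :
  block_bound X C -> block_bound (fun d c => rmx_coord 0 (X d c)) C.
Proof.
move=> XC y.
have h1 : hs (rmx K 0) (rmx K 0) = 1 by rewrite hs_rmx.
have := XC (fun c => kron (y c) (rmx K 0)).
under [X in _ <= _ * X -> _]eq_bigr do rewrite hs_kron h1 mulr1.
apply: le_trans; apply: ler_sum => d _.
rewrite hs_coord_sum big_ord_recl/=.
have -> : rmx_coord 0 (\sum_c X d c *m kron (y c) (rmx K 0)) =
    \sum_c rmx_coord 0 (X d c) *m y c.
  rewrite coord_suml; apply: eq_bigr => c _; apply: hs_nondeg => z.
  by rewrite hs_coord// !hsMr hs_coord// kron_adj kron_mul rmx0 adjmx1 mulmx1.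
by rewrite lerDl sumr_ge0// => q _; apply: hs_ge0.
Qed.

(** X (x) 1 acts separately on the four components of a column, which are
    orthogonal. *)
Lemma block_bound_kron1 nu n (X : 'I_n -> 'I_n -> 'M[K]_(2 ^ nu)) C :
  block_bound X C -> block_bound (fun d c => kron (X d c) 1%:M) C.
Proof.
move=> XC y.
under eq_bigr do rewrite hs_coord_sum.
rewrite exchange_big/=.
have -> : \sum_c hs (y c) (y c) =
    \sum_(q < 4) \sum_c hs (rmx_coord q (y c)) (rmx_coord q (y c)).
  by rewrite exchange_big/=; apply: eq_bigr => c _; rewrite hs_coord_sum.
rewrite mulr_sumr; apply: ler_sum => q _; apply: le_trans (XC _).
rewrite le_eqVlt; apply/orP; left; apply/eqP; apply: eq_bigr => d _.
suff -> : rmx_coord q (\sum_c kron (X d c) 1%:M *m y c) = \sum_c X d c *m rmx_coord q (y c).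
  by [].
by rewrite coord_suml; apply: eq_bigr => c _; rewrite coord_kron1M.
Qed.

Lemma kron_unitary q nu : adjmx (kron (1%:M : 'M[K]_(2 ^ nu)) (rmx K q)) *m
  kron 1%:M (rmx K q) = 1%:M.
Proof.
by rewrite kron_adj kron_mul adjmx1 mulmx1 (mulmx1C (rmx_unitary K q)) kron11.
Qed.

Lemma kron_adj_unitary q nu : adjmx (kron (1%:M : 'M[K]_(2 ^ nu)) (adjmx (rmx K q))) *m
  kron 1%:M (adjmx (rmx K q)) = 1%:M.
Proof. by rewrite kron_adj adjmxK kron_mul adjmx1 mulmx1 rmx_unitary kron11. Qed.

Lemma block_bound_kron nu n (X : 'I_n -> 'I_n -> 'M[K]_(2 ^ nu)) C q :
  block_bound X C -> block_bound (fun d c => kron (X d c) (adjmx (rmx K q))) C.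
Proof.
move=> /block_bound_kron1/(block_bound_mulr (unitary_contractive (kron_adj_unitary q nu))).
by apply: block_bound_eq => d c; rewrite kron_mul mulmx1 mul1mx.
Qed.

Lemma block_bound_coord nu n (X : 'I_n -> 'I_n -> 'M[K]_(2 ^ nu.+1)) C q :
  block_bound X C ->
  block_bound (fun d c => rmx_coord 0 (kron 1%:M (rmx K q) *m X d c)) C.
Proof.
by move=> /(block_bound_mull (unitary_contractive (kron_unitary q nu)))/block_bound_coord0.
Qed.

Lemma block_bound_munit nu n (X : 'I_n -> 'I_n -> 'M[K]_(2 ^ nu)) C k :
  block_bound X C ->
  block_bound (fun d c => dual_prefix (munit K nu) k (X d c)) (10 * C).
Proof.
move=> XC; pose p A := \sum_(a < A) @unitmx_at K nu a.+1 a.+1.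
have pXp A B : block_bound (fun d c => p A *m X d c *m p B) C.
  apply: (@block_bound_mulr _ _ (p B) (fun d c => p A *m X d c)).
    exact: corner_contractive.
  by apply: block_bound_mull XC; apply: corner_contractive.
have [A [B [D [A' [B' [D' e]]]]]] := dual_prefix_corners K nu k.
apply: (@block_bound_eq _ _ (fun d c =>
   p A *m X d c *m p A' + p B *m X d c *m p B' + - (p D *m X d c *m p D'))).
  by move=> d c; rewrite e.
apply: block_bound_le (block_boundD (block_boundD (pXp A A') (pXp B B'))
  (block_boundN (pXp D D'))).
by lia.
Qed.

(** Induction on the level. A prefix within the first block is a prefix of the
    previous level, with the same constant; this is why the bound does not
    grow with nu. A longer prefix is made of at most three full components,
    each bounded by C, and one prefix of matrix units, bounded by 10 C; adding
    them costs 2 * (4 ^ 3 + 10) = 148. *)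
Lemma block_bound_haar nu n (X : 'I_n -> 'I_n -> 'M[K]_(2 ^ nu)) C P :
  (P <= 4 ^ nu)%N -> block_bound X C ->
  block_bound (fun d c => dual_prefix (@haar_basis K nu) P (X d c)) (148 * C).
Proof.
elim: nu X P => [|nu IH] X P Pn XC.
  case: P Pn => [|[|//]] _.
    apply: (@block_bound_eq 0 n (fun _ _ => 0)); last exact: block_bound0.
    by move=> d c; rewrite /dual_prefix big_ord0.
  apply: (@block_bound_le 0 n _ C); first by lia.
  apply: (@block_bound_eq 0 n X) XC => d c.
  exact/esym/(@dual_prefix_full K 0)/haar_orth_basis.
have [q [k [q4 kn ->]]] : exists q k, [/\ (q < 4)%N, (k <= 4 ^ nu)%N &
    P = q * 4 ^ nu + k]%N.
  move: Pn; rewrite leq_eqVlt => /orP[/eqP ->|/pow4S_split[q [k [? ? ->]]]].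
    (* The whole basis is the last block taken to its end. *)
    by exists 3%N, (4 ^ nu)%N; rewrite expnS; split => //; lia.
  by exists q, k; split => //; apply: ltnW.
pose W p d c := rmx_coord 0 (kron 1%:M (rmx K p) *m X d c).
apply: (@block_bound_eq _ _ (fun d c => \sum_(p < q) kron (W p d c) (adjmx (rmx K p)) +
    kron (dual_prefix (@haar_factor K nu q) k (W q d c)) (adjmx (rmx K q)))).
  by move=> d c; rewrite dual_prefixS.
have WC p : block_bound (W p) C by apply: block_bound_coord.
case: q q4 => [|q] q4.
  apply: (@block_bound_eq _ _ (fun d c =>
    kron (dual_prefix (@haar_basis K nu) k (W 0%N d c)) (adjmx (rmx K 0)))).
    by move=> d c; rewrite big_ord0 add0r.
  exact/block_bound_kron/IH.
have S := block_bound_sum (fun p : 'I_q.+1 => block_bound_kron p (WC p)).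
have M := block_bound_kron q.+1 (block_bound_munit k (WC q.+1)).
apply: block_bound_le (block_boundD S M).
have : (4 ^ q.+1 <= 4 ^ 3)%N by rewrite leq_exp2l.
by nia.
Qed.

(** The tensor products of the r_q are unitary and span. *)
Lemma unitary_span nu (y : 'M[K]_(2 ^ nu)) : exists n (c : 'I_n -> K)
    (u : 'I_n -> 'M[K]_(2 ^ nu)),
  (forall i, u i *m adjmx (u i) = 1%:M) /\ y = \sum_i c i *: u i.
Proof.
pose S nu (y : 'M[K]_(2 ^ nu)) := exists n (c : 'I_n -> K)
    (u : 'I_n -> 'M[K]_(2 ^ nu)),
  (forall i, u i *m adjmx (u i) = 1%:M) /\ y = \sum_i c i *: u i.
have S0 mu : S mu 0 by exists 0%N, (fun=> 0), (fun=> 0); split => [[]//|]; rewrite big_ord0.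
have SD mu x z : S mu x -> S mu z -> S mu (x + z).
  move=> [m [c [u [uu ->]]]] [m' [c' [u' [uu' ->]]]].
  exists (m + m')%N, (fun i => match fintype.split i with inl a => c a | inr a => c' a end),
    (fun i => match fintype.split i with inl a => u a | inr a => u' a end); split.
    by move=> i; case: (fintype.split i).
  rewrite big_split_ord/=; congr (_ + _); apply: eq_bigr => i _.
    by rewrite (unsplitK (inl i)).
  by rewrite (unsplitK (inr i)).
elim: nu y => [|nu IH] y; rewrite -/(S _ y).
  exists 1%N, (fun=> y ord0 ord0), (fun=> 1%:M); rewrite adjmx1 mul1mx big_ord1.
  split => //; rewrite {1}[y]mx11_scalar scalemx1.
  by congr (y _ _)%:M; apply: val_inj.
have h q : S nu.+1 (kron (rmx_coord q y) (rmx K q)).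
  have [m [c [u [uu ->]]]] := IH (rmx_coord q y).
  exists m, c, (fun i => kron (u i) (rmx K q)); split => [i|].
    by rewrite kron_adj kron_mul uu rmx_unitary kron11.
  by rewrite kron_suml; apply: eq_bigr => i _; rewrite kronZl.
by rewrite (coord_sum y); apply: (big_ind (S nu.+1) (S0 _) (@SD _)) => q _; exact: h.
Qed.
End BlockBounds.

(** * Approximation in normed spaces *)

Section Adherence.
Variable K : numClosedFieldType.

(** Membership in the closure of S, in terms of norms. *)
Definition adh (V : normedModType K) (S : set V) (v : V) : Prop :=
  forall e : K, 0 < e -> exists2 u, S u & `|v - u| < e.

Lemma dense_adh (V : normedModType K) (S : set V) v : dense S -> adh S v.
Proof.
move=> dS e e0.
have [|u [Bu Su]] := dS (interior (ball v e)) _ (open_interior _).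
  by exists v; apply: nbhsx_ballx.
exists u => //; have := interior_subset Bu.
by rewrite -ball_normE.
Qed.

Lemma adh_sub (V : normedModType K) (S : set V) v : S v -> adh S v.
Proof. by move=> Sv e e0; exists v => //; rewrite subrr normr0. Qed.

Lemma adh_trans (V : normedModType K) (S E : set V) v :
  (forall u, S u -> adh E u) -> adh S v -> adh E v.
Proof.
move=> SE Sv e e0; have e2 : 0 < e / 2 by rewrite divr_gt0.
have [u Su vu] := Sv _ e2; have [w Ew uw] := SE u Su _ e2.
exists w => //; rewrite [e]splitr -[v](subrK u) -addrA.
by apply: le_lt_trans (ler_normD _ _) _; apply: ltrD.
Qed.

Lemma adh_map (V W : normedModType K) (S : set V) (E : set W) (T : V -> W) C v :
  0 <= C -> (forall v v', `|T v - T v'| <= C * `|v - v'|) ->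
  (forall u, S u -> E (T u)) -> adh S v -> adh E (T v).
Proof.
move=> C0 TC TE Sv e e0; have c1 : 0 < C + 1 by rewrite ltr_wpDl.
have [u Su vu] := Sv (e / (C + 1)) (divr_gt0 e0 c1).
exists (T u); first exact: TE.
apply: le_lt_trans (TC _ _) _; move: vu; rewrite ltr_pdivlMr// => vu.
by apply: le_lt_trans vu; rewrite mulrC ler_wpM2l// lerDl.
Qed.

Definition linsub (V : lmodType K) (E : set V) :=
  E 0 /\ forall a v w, E v -> E w -> E (a *: v + w).

Lemma linsub_sum (V : lmodType K) (E : set V) I (r : seq I) (c : I -> K) (s : I -> V) :
  linsub E -> (forall i, E (s i)) -> E (\sum_(i <- r) c i *: s i).
Proof.
move=> [E0 EL] Es; elim: r => [|i r IH]; first by rewrite big_nil.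
by rewrite big_cons; apply: EL.
Qed.

Lemma adh_linsub (V : normedModType K) (E : set V) : linsub E -> linsub (adh E).
Proof.
move=> [E0 EL]; split; first exact: adh_sub.
move=> a v w Ev Ew e e0; have e2 : 0 < e / 2 by rewrite divr_gt0.
have a1 : 0 < `|a| + 1 by rewrite ltr_wpDl.
have [v' Ev' vv'] := Ev (e / 2 / (`|a| + 1)) (divr_gt0 e2 a1).
have [w' Ew' ww'] := Ew _ e2.
exists (a *: v' + w'); first exact: EL.
rewrite opprD addrACA -scalerBr; apply: le_lt_trans (ler_normD _ _) _.
rewrite [e]splitr ler_ltD// normrZ.
move: vv'; rewrite ltr_pdivlMr// => /ltW; apply: le_trans.
by rewrite mulrC ler_wpM2l// lerDl.
Qed.

Lemma adh_span (V : normedModType K) (S E : set V) v :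
  linsub E -> (forall u, S u -> adh E u) -> dense (span S) -> adh E v.
Proof.
move=> sE SE dS; apply: adh_trans (dense_adh _ dS) => u [n [c [s [Ss ->]]]].
by apply: linsub_sum => [|i]; [exact: adh_linsub|exact: SE].
Qed.

Lemma adh_zero (V : normedModType K) (S : set V) (h : V -> K) C :
  0 <= C -> (forall v v', `|h v - h v'| <= C * `|v - v'|) ->
  (forall u, S u -> h u = 0) -> forall v, adh S v -> h v = 0.
Proof.
move=> C0 hC hS v /(@adh_map V (K^o) S [set 0] h C v C0 hC hS) hv.
apply/eqP; apply: contraT => nz; have [|_ ->] := hv `|h v|; first by rewrite normr_gt0.
by rewrite subr0 ltxx.
Qed.

(** C serves to pass to the limit, and the better bound B on the dense set
    survives it. *)
Lemma adh_le (V W : normedModType K) (S : set V) (T : V -> W) B C v :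
  0 <= C -> 0 <= B -> (forall v v', `|T v - T v'| <= C * `|v - v'|) ->
  (forall u, S u -> `|T u| <= B * `|u|) -> adh S v -> `|T v| <= B * `|v|.
Proof.
move=> C0 B0 TC TS Sv.
have r1 : `|T v| \is Num.real by [].
have r2 : B * `|v| \is Num.real by rewrite realM// ger0_real.
rewrite real_leNgt//; apply/negP => lt.
pose e := `|T v| - B * `|v|; have e0 : 0 < e by rewrite subr_gt0.
have c1 : 0 < B + C + 1 by rewrite ltr_wpDl// addr_ge0.
have [u Su vu] := Sv (e / (B + C + 1)) (divr_gt0 e0 c1).
move: vu; rewrite ltr_pdivlMr// => vu.
have : e < e.
  apply: le_lt_trans vu; apply: (@le_trans _ _ (`|v - u| * (B + C))); last first.
    by rewrite ler_wpM2l// lerDl.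
  rewrite lerBlDr; apply: (@le_trans _ _ (C * `|v - u| + B * `|u|)).
    rewrite -{1}[T v](subrK (T u)); apply: le_trans (ler_normD _ _) _.
    by rewrite lerD// TS.
  have -> : `|v - u| * (B + C) + B * `|v| = C * `|v - u| + B * (`|v - u| + `|v|) by ring.
  rewrite lerD2l ler_wpM2l// -{1}[u](subrK v) distrC.
  exact: ler_normD.
by rewrite ltxx.
Qed.

End Adherence.

(** * Inner products *)

Section Hilbert.
Variable K : numClosedFieldType.
Section Dot.
Variable V : hilbertType K.
Implicit Types x y z : V.

Lemma dotDl x y z : dot (x + y) z = dot x z + dot y z.
Proof. by rewrite -[x]scale1r dot_linearl mul1r scale1r. Qed.

Lemma dot0l z : dot 0 z = 0.
Proof. by apply: (addIr (dot 0 z)); rewrite -dotDl addr0 add0r. Qed.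

Lemma dotZl a x z : dot (a *: x) z = a * dot x z.
Proof. by rewrite -[a *: x]addr0 dot_linearl dot0l addr0. Qed.

Lemma dotDr x y z : dot z (x + y) = dot z x + dot z y.
Proof. by rewrite dot_conj dotDl rmorphD/= -!dot_conj. Qed.

Lemma dot0r z : dot z 0 = 0.
Proof. by rewrite dot_conj dot0l conjC0. Qed.

Lemma dotZr a x z : dot z (a *: x) = a^* * dot z x.
Proof. by rewrite dot_conj dotZl rmorphM/= -dot_conj. Qed.

Lemma dotNl x z : dot (- x) z = - dot x z.
Proof. by rewrite -scaleN1r dotZl mulN1r. Qed.

Lemma dotNr x z : dot z (- x) = - dot z x.
Proof. by rewrite -scaleN1r dotZr rmorphN1 mulN1r. Qed.

Lemma dotBl x y z : dot (x - y) z = dot x z - dot y z.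
Proof. by rewrite dotDl dotNl. Qed.

Lemma dotBr x y z : dot z (x - y) = dot z x - dot z y.
Proof. by rewrite dotDr dotNr. Qed.

Lemma dot_suml I (r : seq I) (P : pred I) (F : I -> V) z :
  dot (\sum_(i <- r | P i) F i) z = \sum_(i <- r | P i) dot (F i) z.
Proof.
by apply: (big_morph (fun x => dot x z)) => [x y|]; rewrite ?dotDl ?dot0l.
Qed.

Lemma dot_sumr I (r : seq I) (P : pred I) (F : I -> V) z :
  dot z (\sum_(i <- r | P i) F i) = \sum_(i <- r | P i) dot z (F i).
Proof. by apply: (big_morph (dot z)) => [x y|]; rewrite ?dotDr ?dot0r. Qed.

Lemma cauchy_schwarz x y : `|dot x y| <= `|x| * `|y|.
Proof.
have [->|y0] := eqVneq y 0; first by rewrite dot0r !normr0 mulr0.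
have ny : 0 < dot y y by rewrite dot_norm exprn_gt0// normr_gt0.
rewrite -(@ler_pXn2r _ 2)// ?nnegrE ?mulr_ge0// exprMn -!dot_norm normCK.
pose a := dot x y / dot y y.
have : 0 <= dot (x - a *: y) (x - a *: y) by rewrite dot_norm exprn_ge0.
have ry : (dot y y)^* = dot y y by rewrite -dot_conj.
rewrite dotBl !dotBr !dotZl !dotZr.
have -> : a^* = (dot x y)^* / dot y y by rewrite rmorphM/= fmorphV/= ry.
have -> : (dot x y)^* = dot y x by rewrite -dot_conj.
rewrite /a => h; rewrite -subr_ge0.
move: (mulr_ge0 h (ltW ny)); congr (0 <= _).
by field; rewrite gt_eqF.
Qed.

End Dot.
End Hilbert.

(** * Extension of bounded maps from a total family *)

Lemma bounded_linear_lip (K : numClosedFieldType) (V W : normedModType K)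
    (T : V -> W) B : linear T -> (forall v, `|T v| <= B * `|v|) ->
  forall v v', `|T v - T v'| <= B * `|v - v'|.
Proof.
move=> Tl TB v v'; suff -> : T v - T v' = T (v - v') by [].
have -> : v - v' = -1 *: v' + v by rewrite scaleN1r addrC.
by rewrite Tl scaleN1r addrC.
Qed.

Section Extension.
Variable K : numClosedFieldType.
Variables V W : hilbertType K.

(** The closure of the graph is a graph because of the bound, and it is total
    because a Cauchy filter converges in W. Filters replace sequences since
    the scalars are not assumed to be archimedean. *)
Lemma extend_graph (G0 : V -> W -> Prop) (B : K) : 0 <= B ->
  (forall a v w v' w', G0 v w -> G0 v' w' -> G0 (a *: v + v') (a *: w + w')) ->
  (forall v w, G0 v w -> `|w| <= B * `|v|) ->
  (forall v, adh [set v | exists w, G0 v w] v) ->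
  exists T : V -> W, [/\ linear T, forall v, `|T v| <= B * `|v| &
    forall v w, G0 v w -> T v = w].
Proof.
move=> B0 GL GB Gd.
have G0s v w v' w' : G0 v w -> G0 v' w' -> G0 (v - v') (w - w').
  by move=> h h'; have := GL (-1) _ _ _ _ h' h; rewrite !scaleN1r ![- _ + _]addrC.
pose G v w := forall e : K, 0 < e ->
  exists v' w', [/\ G0 v' w', `|v - v'| < e & `|w - w'| < e].
have GL' a v w v' w' : G v w -> G v' w' -> G (a *: v + v') (a *: w + w').
  move=> h h' e e0; have e2 : 0 < e / 2 by rewrite divr_gt0.
  have a1 : 0 < `|a| + 1 by rewrite ltr_wpDl.
  have [v1 [w1 [g1 d1 d1']]] := h _ (divr_gt0 e2 a1).
  have [v2 [w2 [g2 d2 d2']]] := h' _ e2.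
  exists (a *: v1 + v2), (a *: w1 + w2); split; first exact: GL.
    rewrite opprD addrACA -scalerBr; apply: le_lt_trans (ler_normD _ _) _.
    rewrite [e]splitr ler_ltD// normrZ.
    move: d1; rewrite ltr_pdivlMr// => /ltW; apply: le_trans.
    by rewrite mulrC ler_wpM2l// lerDl.
  rewrite opprD addrACA -scalerBr; apply: le_lt_trans (ler_normD _ _) _.
  rewrite [e]splitr ler_ltD// normrZ.
  move: d1'; rewrite ltr_pdivlMr// => /ltW; apply: le_trans.
  by rewrite mulrC ler_wpM2l// lerDl.
have GB' v w : G v w -> `|w| <= B * `|v|.
  move=> h.
  have r1 : `|w| \is Num.real by [].
  have r2 : B * `|v| \is Num.real by rewrite realM// ger0_real.
  rewrite real_leNgt//; apply/negP => lt.
  pose e := `|w| - B * `|v|; have e0 : 0 < e by rewrite subr_gt0.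
  have c1 : 0 < B + 1 by rewrite ltr_wpDl.
  have [v' [w' [g d d']]] := h _ (divr_gt0 e0 c1).
  have : e < e.
    rewrite {2}(_ : e = (e / (B + 1)) + B * (e / (B + 1))); last first.
      by field; rewrite gt_eqF.
    apply: (@le_lt_trans _ _ (`|w - w'| + B * `|v - v'|)); last first.
      by rewrite ltr_leD// ler_wpM2l// ltW.
    rewrite lerBlDr -{1}[w](subrK w'); apply: le_trans (ler_normD _ _) _.
    rewrite -addrA lerD2l -mulrDr; apply: le_trans (GB _ _ g) _.
    rewrite ler_wpM2l// -{1}[v'](subrK v) distrC; exact: ler_normD.
  by rewrite ltxx.
have G00 v w : G0 v w -> G v w.
  by move=> g e e0; exists v, w; rewrite !subrr !normr0.
have Gu v w w' : G v w -> G v w' -> w = w'.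
  move=> h h'; apply/eqP; rewrite -subr_eq0 -normr_le0.
  have := GB' _ _ (GL' (-1) _ _ _ _ h' h); rewrite !scaleN1r addNr normr0 mulr0.
  by rewrite addrC.
have Gt v : exists w, G v w.
  have emin (e e' : K) : 0 < e -> 0 < e' -> exists e'', [/\ 0 < e'', e'' <= e & e'' <= e'].
    move=> e0 e'0; have [l|/ltW l] := real_leP (gtr0_real e0) (gtr0_real e'0).
      by exists e.
    by exists e'.
  pose b (e : K) := [set w | exists v', G0 v' w /\ `|v - v'| < e].
  pose F := filter_from [set e : K | 0 < e] b.
  have bS e e' : e <= e' -> b e `<=` b e'.
    by move=> ee w [v' [g d]]; exists v'; split => //; apply: lt_le_trans ee.
  have FF : ProperFilter F.
    apply: filter_from_proper; last first.
      move=> e e0; have [v' [w g] d] := Gd v e e0.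
      by exists w, v'.
    apply: filter_from_filter; first by exists 1; rewrite /= ltr01.
    move=> e e' /= e0 e'0; have [e'' [e''0 le le']] := emin e e' e0 e'0.
    by exists e'' => // w bw; split; [exact: bS le _ bw|exact: bS le' _ bw].
  have Fc : cauchy F.
    apply: cauchy_exP => e e0; have c1 : 0 < B + 1 by rewrite ltr_wpDl.
    pose e1 := e / (B + 1) / 2; have e10 : 0 < e1 by rewrite !divr_gt0.
    have [v' [w' g] d] := Gd v e1 e10.
    (* Images of points e1-close to v are B * (2 * e1)-close to w'. *)
    exists w'; exists e1 => // w'' [v'' [g' d']].
    rewrite -ball_normE /=; apply: le_lt_trans (GB _ _ (G0s _ _ _ _ g g')) _.
    apply: (@le_lt_trans _ _ (B * (e1 + e1))).
      rewrite ler_wpM2l// -[v' - v''](subrKA v) (le_trans (ler_normD _ _))//.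
      by rewrite lerD// ltW// distrC.
    by rewrite /e1 -splitr mulrCA gtr_pMr// ltr_pdivrMr// mul1r ltrDl.
  have /cauchy_cvgP Fv := Fc.
  exists (lim F) => e e0.
  have : F (ball (lim F) e) by apply: Fv; apply: nbhsx_ballx.
  case=> e' /= e'0 be; have [e'' [e''0 le le']] := emin e e' e0 e'0.
  have [v' [w' g] d] := Gd v e'' e''0.
  exists v', w'; split => //; first exact: lt_le_trans le.
  have /be : b e' w' by exists v'; split => //; exact: lt_le_trans le'.
  by rewrite -ball_normE.
pose T v := xget 0 [set w | G v w].
have TG v : G v (T v) by rewrite /T; case: xgetP => //= h; have [w /h] := Gt v.
exists T; split => [a v v'|v|v w g]; last 1 first.
- exact: Gu (TG v) (G00 _ _ g).
- by apply: Gu (TG _) _; apply: GL'.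
- exact: GB'.
Qed.
End Extension.

Section SpanExtension.
Variable K : numClosedFieldType.
Variables V W : hilbertType K.

(** Lists of weighted indices make linear combinations closed under
    concatenation. *)
Definition lincomb I (U : lmodType K) (f : I -> U) (r : seq (K * I)) : U :=
  \sum_(p <- r) p.1 *: f p.2.

Lemma lincombDZ I (U : lmodType K) (f : I -> U) a r r' :
  a *: lincomb f r + lincomb f r' =
  lincomb f ([seq (a * p.1, p.2) | p <- r] ++ r').
Proof.
rewrite /lincomb big_cat big_map scaler_sumr; congr (_ + _).
by apply: eq_bigr => p _; rewrite scalerA.
Qed.

Lemma span_lincomb I (U : lmodType K) (f : I -> U) v : span (range f) v ->
  exists r, v = lincomb f r.
Proof.
move=> [n [c [s [Ss ->]]]].
have /boolp.choice[t ht] : forall i, exists t, f t = s i.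
  by move=> i; have [t _ e] := Ss i; exists t.
exists [seq (c i, t i) | i <- enum 'I_n].
by rewrite /lincomb big_map big_enum; apply: eq_bigr => i _; rewrite ht.
Qed.

Lemma extend_span I (f : I -> V) (g : I -> W) B : 0 <= B ->
  dense (span (range f)) ->
  (forall r, `|lincomb g r| <= B * `|lincomb f r|) ->
  exists T : V -> W, [/\ linear T, forall v, `|T v| <= B * `|v| &
    forall i, T (f i) = g i].
Proof.
move=> B0 fd gf.
pose G0 v w := exists r, v = lincomb f r /\ w = lincomb g r.
have [a v w v' w'|v w|v|T [Tl TB TG]] := @extend_graph K V W G0 B B0.
- by move=> [r [-> ->]] [r' [-> ->]]; eexists; split; apply: lincombDZ.
- by move=> [r [-> ->]].
- apply: adh_trans (dense_adh v fd) => u /span_lincomb[r ->].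
  by apply: adh_sub; exists (lincomb g r), r.
exists T; split => // i; apply: TG.
by exists [:: (1, i)]; rewrite /lincomb !big_seq1 !scale1r.
Qed.

Lemma dot_lincomb I (U : hilbertType K) (f : I -> U) r r' :
  dot (lincomb f r) (lincomb f r') =
  \sum_(p <- r) \sum_(q <- r') p.1 * (q.1)^* * dot (f p.2) (f q.2).
Proof.
rewrite dot_suml; apply: eq_bigr => p _; rewrite dot_sumr; apply: eq_bigr => q _.
by rewrite dotZl dotZr mulrA.
Qed.

Lemma dot_lipschitz (U : hilbertType K) (z v v' : U) :
  `|dot v z - dot v' z| <= `|z| * `|v - v'|.
Proof. by rewrite -dotBl mulrC cauchy_schwarz. Qed.

(** Agreement of the inner products on the generators makes the extension well
    defined and isometric. *)
Lemma extend_isometry I (f : I -> V) (g : I -> W) :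
  dense (span (range f)) ->
  (forall i k, dot (g i) (g k) = dot (f i) (f k)) ->
  exists T : V -> W, [/\ linear T, forall v, `|T v| <= 1 * `|v|,
    forall v w, dot (T v) (T w) = dot v w & forall i, T (f i) = g i].
Proof.
move=> fd gf.
have gl r r' : dot (lincomb g r) (lincomb g r') = dot (lincomb f r) (lincomb f r').
  rewrite !dot_lincomb; apply: eq_bigr => p _; apply: eq_bigr => q _.
  by rewrite gf.
have [||r|T [Tl TB Tf]] := @extend_span I f g 1; rewrite ?ler01//.
  rewrite mul1r -(@ler_pXn2r _ 2) ?nnegrE// -!dot_norm gl//.
exists T; split => // v w.
have TL := bounded_linear_lip Tl TB.
have Tr r : T (lincomb f r) = lincomb g r.
  have T0 : T 0 = 0 by have := TB 0; rewrite normr0 mulr0 normr_le0 => /eqP.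
  rewrite /lincomb; elim: r => [|p r IH]; rewrite ?big_nil// !big_cons Tl IH.
  by rewrite Tf.
have ex u : span (range f) u -> exists r, u = lincomb f r /\ T u = lincomb g r.
  by move=> /span_lincomb[r ->]; exists r; rewrite Tr.
have lip (z z' : V) x y : `|(dot (T x) (T z) - dot x z) - (dot (T y) (T z) - dot y z)|
    <= (`|T z| + `|z|) * `|x - y|.
  have -> (a b c d : K) : a - b - (c - d) = (a - c) - (b - d) by ring.
  apply: le_trans (ler_normB _ _) _; rewrite mulrDl lerD ?dot_lipschitz//.
  apply: le_trans (dot_lipschitz _ _ _) _; rewrite ler_wpM2l//.
  by rewrite -[X in _ <= X]mul1r.
have h1 u x : span (range f) u -> dot (T x) (T u) - dot x u = 0.
  move=> Su; move: x (dense_adh x fd).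
  move=> x; apply: (@adh_zero _ _ _ (fun x => dot (T x) (T u) - dot x u)
    (`|T u| + `|u|)) x => [||x Sx].
  - by rewrite addr_ge0.
  - by move=> *; apply: lip.
  have [r [-> ->]] := ex _ Su; have [r' [-> ->]] := ex _ Sx.
  by rewrite gl subrr.
apply/eqP; rewrite -subr_eq0; apply/eqP; move: w (dense_adh w fd).
have h2 u x : dot (T u) (T x) - dot u x = (dot (T x) (T u) - dot x u)^*.
  by rewrite rmorphB/= -!dot_conj.
apply: (@adh_zero _ _ _ (fun w => dot (T v) (T w) - dot v w) (`|T v| + `|v|)).
- by rewrite addr_ge0.
- by move=> x y; rewrite 2!(h2 v) -rmorphB norm_conjC lip.
- by move=> u Su; rewrite h1.
Qed.

End SpanExtension.

(** * Bounded operators *)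

Section Agreement.
Variable K : numClosedFieldType.

Lemma adh_eq (V W : hilbertType K) (S : set V) (T1 T2 : V -> W) C1 C2 v :
  0 <= C1 -> 0 <= C2 ->
  (forall v v', `|T1 v - T1 v'| <= C1 * `|v - v'|) ->
  (forall v v', `|T2 v - T2 v'| <= C2 * `|v - v'|) ->
  (forall u, S u -> T1 u = T2 u) -> adh S v -> T1 v = T2 v.
Proof.
move=> C10 C20 TC1 TC2 TS Sv; apply/eqP; rewrite -subr_eq0 -normr_eq0; apply/eqP.
apply: (@adh_zero _ _ S (fun v => `|T1 v - T2 v|) (C1 + C2)) => //.
- exact: addr_ge0.
- move=> x y; apply: le_trans (ler_dist_dist _ _) _.
  have -> : T1 x - T2 x - (T1 y - T2 y) = (T1 x - T1 y) - (T2 x - T2 y).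
    by rewrite !opprB addrACA [RHS]addrACA; congr (_ + _); rewrite addrC.
  by rewrite mulrDl; apply: le_trans (ler_normB _ _) _; rewrite lerD.
- by move=> u Su; rewrite TS// subrr normr0.
Qed.

Lemma dense_subset (V : topologicalType) (S S' : set V) :
  S `<=` S' -> dense S -> dense S'.
Proof. by move=> SS d O O0 oO; have [x [Ox /SS]] := d O O0 oO; exists x. Qed.

Lemma bounded_op_lip (V : hilbertType K) (T : V -> V) : bounded_op T ->
  exists2 C : K, 0 <= C & forall v v', `|T v - T v'| <= C * `|v - v'|.
Proof.
move=> [Tl [B TB]].
have [v0|] := pselect (exists v : V, v != 0).
  have [v vn] := v0; have B0 : 0 <= B.
    have := le_trans (normr_ge0 _) (TB v).
    by rewrite pmulr_lge0// normr_gt0.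
  by exists B => //; apply: bounded_linear_lip.
move=> nv; exists 0 => // v v'; have z (w : V) : w = 0.
  by apply/eqP; apply: contraT => wn; case: nv; exists w.
by rewrite (z (T v)) (z (T v')) subrr normr0 mul0r.
Qed.

Lemma linear_map0 (V W : lmodType K) (T : V -> W) : linear T -> T 0 = 0.
Proof.
move=> Tl; apply: (addIr (T 0)); rewrite add0r.
by have := Tl 1 0 0; rewrite scaler0 addr0 scale1r.
Qed.

Lemma linear_mapZ (V W : lmodType K) (T : V -> W) : linear T ->
  forall a v, T (a *: v) = a *: T v.
Proof. by move=> Tl a v; rewrite -[a *: v]addr0 Tl linear_map0 ?addr0. Qed.

Lemma linear_mapD (V W : lmodType K) (T : V -> W) : linear T ->
  forall v w, T (v + w) = T v + T w.
Proof. by move=> Tl v w; rewrite -{1}[v]scale1r Tl scale1r. Qed.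

Lemma linear_map_sum (V W : lmodType K) (T : V -> W) : linear T ->
  forall I (r : seq I) (P : pred I) F,
  T (\sum_(i <- r | P i) F i) = \sum_(i <- r | P i) T (F i).
Proof.
move=> Tl I r P F; apply: (big_morph T); [exact: linear_mapD|exact: linear_map0].
Qed.

End Agreement.

(** * Dominated series of scalars *)

Section Series.
Variable K : numClosedFieldType.

Lemma cvg_series_single (z : nat -> K^o) i : (forall k, k != i -> z k = 0) ->
  series z @ \oo --> z i.
Proof.
move=> zi; apply/cvgrPdist_lt => e e0; exists i.+1 => // n /= lt.
rewrite seriesEnat /= big_mkord (bigD1 (Ordinal lt))//= big1 ?addr0 => [|k ki].
  by rewrite subrr normr0.
by apply: zi; apply: contraNneq ki => e'; apply/eqP/val_inj.
Qed.

Lemma lim_series_single (z : nat -> K^o) i : (forall k, k != i -> z k = 0) ->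
  limn (series z) = z i.
Proof. by move=> /cvg_series_single; apply: cvg_lim; apply: norm_hausdorff. Qed.

(** The Cauchy criterion for the series of s. *)
Definition small_tails (s : nat -> K) := forall e : K, 0 < e -> exists N, forall n m,
  (N <= n)%N -> `|\sum_(n <= k < m) s k| < e.

Lemma small_tailsP (V : normedModType K) (s : nat -> V) :
  cauchy (series s @ \oo) <-> forall e : K, 0 < e -> exists N, forall n m,
  (N <= n)%N -> `|\sum_(n <= k < m) s k| < e.
Proof.
rewrite cauchy_seriesP; split => h e e0.
  have [[A B] [[N1 _ h1] [N2 _ h2]] sub] := h e e0.
  exists (maxn N1 N2) => n m le; have [nm|nm] := leqP m n.
    by rewrite big_geq// normr0.
  apply: (sub (n, m)); split => /=.
    by apply: h1 => /=; apply: leq_trans le; rewrite leq_maxl.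
  by apply: h2 => /=; apply: leq_trans (ltnW nm); apply: leq_trans le; rewrite leq_maxr.
have [N hN] := h e e0; exists ([set n | (N <= n)%N], setT) => /=.
  by split; [exists N|apply: filterT].
by move=> [n m] /= [le _]; apply: hN.
Qed.

Lemma small_tailsD s t : small_tails s -> small_tails t ->
  small_tails (fun n => s n + t n).
Proof.
move=> hs ht e e0; have e2 : 0 < e / 2 by rewrite divr_gt0.
have [N hN] := hs _ e2; have [N' hN'] := ht _ e2.
exists (maxn N N') => n m; rewrite geq_max => /andP[le le'].
rewrite big_split [e]splitr; apply: le_lt_trans (ler_normD _ _) _.
by rewrite ltrD ?hN ?hN'.
Qed.

(** The scalars are complete because the line spanned by the unit vector f is:
    the series of z n *: f converges, and its inner product with f recovers
    the sum. The index N does not depend on z, which is what gives uniformity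
    on balls of operators. *)
Lemma dominated_series (V : hilbertType K) (f : V) (s : nat -> K) : `|f| = 1 ->
  small_tails s -> forall e : K, 0 < e -> exists N, forall (z : nat -> K^o) B,
  0 <= B -> (forall n, `|z n| <= B * s n) ->
  `|limn (series z) - \sum_(k < N) z k| <= B * e + e.
Proof.
move=> f1 hs e e0; have [N hN] := hs e e0; exists N => z B B0 zs.
have tail n m : `|\sum_(n <= k < m) z k| <= B * `|\sum_(n <= k < m) s k|.
  apply: le_trans (ler_norm_sum _ _ _) _.
  apply: (@le_trans _ _ (\sum_(n <= k < m) B * s k)); first exact: ler_sum.
  rewrite -mulr_sumr -[B in X in _ <= X]ger0_norm// -normrM real_ler_norm//.
  rewrite mulr_sumr; apply: rpred_sum => k _.
  by apply: ger0_real; apply: le_trans (zs k).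
have cz : cauchy (series (fun n => z n *: f) @ \oo).
  apply/small_tailsP => d d0; have c1 : 0 < B + 1 by rewrite ltr_wpDl.
  have [N' hN'] := hs (d / (B + 1)) (divr_gt0 d0 c1).
  exists N' => n m le; rewrite -scaler_suml normrZ f1 mulr1.
  apply: le_lt_trans (tail _ _) _; have := hN' n m le.
  rewrite ltr_pdivlMr// => /(le_lt_trans _); apply.
  by rewrite mulrC ler_wpM2l// lerDl.
have /cauchy_cvgP/cvg_ex[w hw] := cz.
have hz : series z @ \oo --> (dot w f : K^o).
  apply/cvgrPdist_lt => d d0; have /cvgrPdist_lt /(_ d d0)[N' _ hN'] := hw.
  exists N' => // n /= le; apply: le_lt_trans (hN' n le).
  rewrite (_ : series z n = dot (series (fun n => z n *: f) n) f).
    by rewrite -dotBl; apply: le_trans (cauchy_schwarz _ _) _; rewrite f1 mulr1.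
  rewrite !seriesEnat /= dot_suml; apply: eq_bigr => k _.
  by rewrite dotZl dot_norm f1 expr1n mulr1.
have -> : limn (series z) = dot w f by apply: cvg_lim hz; apply: norm_hausdorff.
have /cvgrPdist_lt /(_ e e0)[N' _ hN'] := hz.
pose m := maxn N N'.
have mN' : (N' <= m)%N by rewrite leq_maxr.
rewrite -(subrK (series z m) (dot w f)) -addrA addrC.
apply: le_trans (ler_normD _ _) _; apply: lerD; last exact: ltW (hN' _ mN').
have -> : series z m - \sum_(k < N) z k = \sum_(N <= k < m) z k.
  by rewrite seriesEnat /= (@big_cat_nat _ _ _ N)//= ?leq_maxl// big_mkord addrAC subrr add0r.
apply: le_trans (tail _ _) _; rewrite ler_wpM2l// ltW// hN//.
Qed.

End Series.

(** * A criterion for Schauder bases of preduals *)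

Section BiorthogonalSums.
Variables (K : numClosedFieldType) (V : hilbertType K).
Variables (u w : nat -> V) (D : nat -> V -> V).

Definition partial_sum T n : V -> V := fun v =>
  \sum_(i < n) dot (T (u i)) (w i) *: D i v.

Definition remainder T n : V -> V := fun v => - 1 *: partial_sum T n v + T v.

Variable M : set (V -> V).
Hypothesis M0 : M (fun=> 0).
Hypothesis MD : forall a S T, M S -> M T -> M (fun v => a *: S v + T v).
Hypothesis MDi : forall i, M (D i).

Lemma M_partial_sum T n : M (partial_sum T n).
Proof.
elim: n => [|n IH].
  by rewrite (_ : partial_sum _ _ = fun=> 0)//; apply/funext => v; rewrite /partial_sum big_ord0.
rewrite (_ : partial_sum _ _ = fun v => dot (T (u n)) (w n) *: D n v + partial_sum T n v).
  exact: MD.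
by apply/funext => v; rewrite /partial_sum big_ord_recr addrC.
Qed.

Lemma M_remainder T n : M T -> M (remainder T n).
Proof. by move=> MT; apply: MD => //; apply: M_partial_sum. Qed.

End BiorthogonalSums.

Section Criterion.
Variable R : realType.
Local Notation C := R[i].
Variables (V : hilbertType C) (M : set (V -> V)).
Hypothesis M_linear : forall T, M T -> linear T.
Hypothesis M_bounded : forall T, M T ->
  exists2 B : C, 0 <= B & forall v, `|T v| <= B * `|v|.
Hypothesis M0 : M (fun=> 0).
Hypothesis MD : forall a S T, M S -> M T -> M (fun v => a *: S v + T v).
Variables (u w : nat -> V) (D : nat -> V -> V) (f : V) (B : C).
Hypothesis f1 : `|f| = 1.
Hypothesis MDi : forall i, M (D i).
Hypothesis biorth : forall i k, dot (D k (u i)) (w i) = (i == k)%:R.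

Notation psum T n := (partial_sum u w D T n).
Notation resid T n := (remainder u w D T n).

Hypothesis B0 : 0 <= B.
Hypothesis remainder_bound : forall T n v, M T -> (forall v, `|T v| <= `|v|) ->
  `|resid T n v| <= B * `|v|.
Variable E : set V.
Hypothesis E_dense : forall v, adh E v.
Hypothesis E_resid : forall x y, E x -> E y -> exists N, forall T n, M T -> (N <= n)%N ->
  dot (resid T n x) y = 0.

Definition contraction (T : V -> V) := M T /\ forall v, `|T v| <= `|v|.

(** Both vectors are replaced by vectors of the dense set, for which the
    coefficient of the remainder vanishes. *)
Lemma remainder_vectors x y e : 0 < e -> exists N, forall T n, contraction T ->
  (N <= n)%N -> `|dot (resid T n x) y| <= e.
Proof.
move=> e0; have e2 : 0 < e / 2 by rewrite divr_gt0.
have c1 : 0 < B * `|y| + 1 by rewrite ltr_wpDl// mulr_ge0.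
have [x' Ex' xx'] := E_dense x (divr_gt0 e2 c1).
have c2 : 0 < B * `|x'| + 1 by rewrite ltr_wpDl// mulr_ge0.
have [y' Ey' yy'] := E_dense y (divr_gt0 e2 c2).
have [N hN] := E_resid Ex' Ey'; exists N => T n [MT T1] le.
set U := resid T n.
have Ul : linear U by apply/M_linear/(M_remainder u w M0 MD MDi).
have Ub v : `|U v| <= B * `|v| by apply: remainder_bound.
have -> : dot (U x) y = dot (U (x - x')) y + dot (U x') (y - y').
  have {1}-> : x = 1 *: (x - x') + x' by rewrite scale1r subrK.
  rewrite Ul scale1r dotDl; congr (_ + _).
  by rewrite dotBr /U hN// subr0.
rewrite [e]splitr; apply: le_trans (ler_normD _ _) _; apply: lerD.
  apply: le_trans (cauchy_schwarz _ _) _.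
  move: xx'; rewrite ltr_pdivlMr// => /ltW; apply: le_trans.
  rewrite mulrDr mulr1 mulrCA mulrA.
  apply: (@le_trans _ _ (B * `|x - x'| * `|y|)); first by rewrite ler_wpM2r.
  by rewrite lerDl.
apply: le_trans (cauchy_schwarz _ _) _.
move: yy'; rewrite ltr_pdivlMr// => /ltW; apply: le_trans.
rewrite mulrDr mulr1 mulrC.
apply: (@le_trans _ _ (`|y - y'| * (B * `|x'|))); first by rewrite ler_wpM2l.
by rewrite lerDl.
Qed.

Lemma remainder_sums (xi eta : nat -> V) N e : 0 < e -> exists N', forall T n,
  contraction T -> (N' <= n)%N ->
  `|\sum_(k < N) dot (resid T n (xi k)) (eta k)| <= e.
Proof.
elim: N e => [|N IH] e e0.
  by exists 0%N => T n _ _; rewrite big_ord0 normr0 ltW.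
have e2 : 0 < e / 2 by rewrite divr_gt0.
have [N1 h1] := IH _ e2; have [N2 h2] := remainder_vectors (xi N) (eta N) e2.
exists (maxn N1 N2) => T n cT; rewrite geq_max => /andP[l1 l2].
rewrite big_ord_recr [e]splitr; apply: le_trans (ler_normD _ _) _.
by rewrite lerD ?h1 ?h2.
Qed.

Lemma square_summable_tails (xi : nat -> V) : square_summable xi ->
  small_tails (fun n => `|xi n| ^+ 2).
Proof.
by move=> /cvg_cauchy/(@small_tailsP C (C^o) (fun n => `|xi n| ^+ 2)).
Qed.

(** The sum is cut at an index that depends on xi and eta only; the tail is
    dominated by the norms, and finitely many coefficients are left. *)
Lemma remainder_sw (xi eta : nat -> V) e : square_summable xi ->
  square_summable eta -> 0 < e -> exists N, forall T n, contraction T -> (N <= n)%N ->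
  `|sw_form xi eta (resid T n)| < e.
Proof.
(* The tail contributes at most B * d + d, which is less than e / 2. *)
move=> sx se e0; pose d := e / 2 / (B + 1 + 1).
have c0 : 0 < B + 1 + 1 by rewrite !ltr_wpDl// addr_ge0.
have e2 : 0 < e / 2 by rewrite divr_gt0.
have d0 : 0 < d by rewrite divr_gt0.
have st := small_tailsD (square_summable_tails sx) (square_summable_tails se).
have [N hN] := dominated_series f1 st d0.
have [N' hN'] := remainder_sums xi eta N e2.
exists N' => T n cT le; have [MT T1] := cT.
set U := resid T n.
have Ub v : `|U v| <= B * `|v| by apply: remainder_bound.
have zb k : `|dot (U (xi k)) (eta k)| <= B * (`|xi k| ^+ 2 + `|eta k| ^+ 2).
  apply: le_trans (cauchy_schwarz _ _) _.
  apply: (@le_trans _ _ (B * `|xi k| * `|eta k|)); first by rewrite ler_wpM2r.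
  rewrite -mulrA ler_wpM2l// -subr_ge0.
  have h : 0 <= (`|xi k| - `|eta k|) ^+ 2.
    by rewrite -realEsqr realB.
  have -> : `|xi k| ^+ 2 + `|eta k| ^+ 2 - `|xi k| * `|eta k| =
     (`|xi k| - `|eta k|) ^+ 2 + `|xi k| * `|eta k| by ring.
  by rewrite addr_ge0// mulr_ge0.
have := hN _ B B0 zb; rewrite -/(sw_form xi eta U) => h.
rewrite -(subrK (\sum_(k < N) dot (U (xi k)) (eta k)) (sw_form xi eta U)).
apply: le_lt_trans (ler_normD _ _) _; rewrite [e]splitr ltr_leD//; last exact: hN'.
apply: le_lt_trans h _; rewrite (_ : B * d + d = (B + 1) * d); last by ring.
by rewrite /d mulrCA gtr_pMr// ltr_pdivrMr// mul1r ltrDl.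
Qed.

Definition mk_mem (T : V -> V) (MT : M T) : set_type M := exist _ T (mem_set MT).

Definition vector_functional (i : nat) : set_type M -> C^o :=
  fun T => dot (val T (u i)) (w i).

Lemma val_mem (T : set_type M) : M (val T).
Proof. exact: set_valP. Qed.

Lemma vector_functional_predual i : predual M (vector_functional i).
Proof.
split.
  by move=> a S T U STU; rewrite /vector_functional STU dotDl dotZl.
move=> T0 e e0.
(* The functional is a form with a single nonzero term. *)
pose xi (x : V) (k : nat) := if k == 0%N then x else 0.
have sx x : square_summable (xi x).
  apply: cvgP; apply: (@cvg_series_single C _ 0%N) => k /negPf k0.
  by rewrite /xi k0 normr0 expr0n.
have sw (T : set_type M) : sw_form (xi (u i)) (xi (w i)) (val T) = vector_functional i T.
  rewrite /sw_form (@lim_series_single _ _ 0%N)// => k /negPf k0.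
  by rewrite /xi k0 dot0r.
exists 1%N, (fun=> xi (u i)), (fun=> xi (w i)), e; split => // T /(_ ord0).
by rewrite !sw.
Qed.

Section Functional.
Variable phi : set_type M -> C^o.
Hypothesis phi_predual : predual M phi.

Lemma phi_eq (S T : set_type M) : (forall v, val S v = val T v) -> phi S = phi T.
Proof. by move=> e; congr phi; apply/val_inj/funext. Qed.

Lemma phiD a S T (MS : M S) (MT : M T) :
  phi (mk_mem (MD a MS MT)) = a * phi (mk_mem MS) + phi (mk_mem MT).
Proof. by have [pl _] := phi_predual; apply: pl. Qed.

Lemma phi0 : phi (mk_mem M0) = 0.
Proof.
have [pl _] := phi_predual; apply: (addIr (phi (mk_mem M0))); rewrite add0r.
rewrite -[X in X + _]mul1r -(pl 1 (mk_mem M0) (mk_mem M0) (mk_mem M0))// => v /=.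
by rewrite scaler0 addr0.
Qed.

Lemma phi_partial_sum T n :
  phi (mk_mem (M_partial_sum u w M0 MD MDi T n)) =
  \sum_(i < n) dot (T (u i)) (w i) * phi (mk_mem (MDi i)).
Proof.
elim: n => [|n IH].
  rewrite big_ord0 -phi0; apply: phi_eq => v /=.
  by rewrite /partial_sum big_ord0.
rewrite big_ord_recr /= -IH addrC -phiD; apply: phi_eq => v /=.
by rewrite /partial_sum big_ord_recr addrC.
Qed.

(** Continuity of phi at 0, applied to the remainder T - P_n T: the finitely
    many forms that control phi are small there by [remainder_sw]. *)
Lemma phi_remainder e : 0 < e -> exists N, forall (T : set_type M) n,
  (forall v, `|val T v| <= `|v|) -> (N <= n)%N ->
  `|phi T - \sum_(i < n) phi (mk_mem (MDi i)) * vector_functional i T| < e.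
Proof.
move=> e0; have [_ /(_ (mk_mem M0) e e0)] := phi_predual.
move=> [m [xi [eta [d [d0 sq h]]]]].
have /boolp.choice[N hN] : forall i, exists N, forall T n, contraction T -> (N <= n)%N ->
    `|sw_form (xi i) (eta i) (resid T n)| < d.
  by move=> i; have [s1 s2] := sq i; apply: remainder_sw.
exists (\max_i N i) => T n T1 le.
have MT := val_mem T.
have := h (mk_mem (M_remainder u w M0 MD MDi n MT)); rewrite phi0 subr0.
suff -> : phi (mk_mem (M_remainder u w M0 MD MDi n MT)) =
    phi T - \sum_(i < n) phi (mk_mem (MDi i)) * vector_functional i T.
  apply => i /=; have -> : sw_form (xi i) (eta i) (fun=> 0) = 0.
    rewrite /sw_form (@lim_series_single _ _ 0%N) ?dot0l// => k _; exact: dot0l.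
  rewrite subr0; apply: hN => //; apply: leq_trans le; exact: leq_bigmax.
rewrite (@phi_eq _ (mk_mem (MD (-1) (M_partial_sum u w M0 MD MDi (val T) n) MT)))//.
rewrite phiD mulN1r addrC phi_partial_sum; congr (_ - _).
  by apply: phi_eq.
by apply: eq_bigr => i _; rewrite mulrC.
Qed.

End Functional.

Lemma unit_ball0 : [set T : set_type M | forall v, `|val T v| <= `|v|] (mk_mem M0).
Proof. by move=> v /=; rewrite normr0. Qed.

Lemma Re_norm (z : C) : (complex.Re `|z|)%:C%C = `|z|.
Proof. by apply: RRe_real; apply: normr_real. Qed.

(** A bound on the unit ball is needed for the supremum to be meaningful. *)
Lemma predual_norm_le (psi : set_type M -> C^o) (e : R) :
  (forall T : set_type M, (forall v, `|val T v| <= `|v|) -> `|psi T| <= e%:C%C) ->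
  0 <= predual_norm M psi <= e /\
  forall T : set_type M, (forall v, `|val T v| <= `|v|) ->
    complex.Re `|psi T| <= predual_norm M psi.
Proof.
move=> h; have ub : ubound [set complex.Re `|psi T| |
        T in [set T : set_type M | forall v, `|val T v| <= `|v|]] e.
  by move=> _ [T T1 <-]; rewrite -lecR Re_norm; apply: h.
have le (T : set_type M) : (forall v, `|val T v| <= `|v|) ->
    complex.Re `|psi T| <= predual_norm M psi.
  by move=> T1; apply: ub_le_sup; [exists e|exists T].
split => //; apply/andP; split.
  apply: le_trans (le _ unit_ball0).
  by rewrite -lecR Re_norm; exact: normr_ge0.
apply: ge_sup => //; exists (complex.Re `|psi (mk_mem M0)|), (mk_mem M0) => //.
exact: unit_ball0.
Qed.

Lemma sub_sumE (phi : set_type M -> C^o) (c : nat -> C) n T :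
  (phi - \sum_(k < n) c k *: vector_functional k) T =
  phi T - \sum_(k < n) c k * vector_functional k T.
Proof.
rewrite [LHS]/(phi T - (\sum_(k < n) c k *: vector_functional k) T); congr (_ - _).
by rewrite fct_sumE.
Qed.

Lemma vector_functional_bound k T : (forall v, `|val T v| <= `|v|) ->
  `|vector_functional k T| <= `|u k| * `|w k|.
Proof.
move=> T1; apply: le_trans (cauchy_schwarz _ _) _.
by rewrite ler_wpM2r.
Qed.

(** The coefficient of index i of phi is phi (D i). For uniqueness, D i is
    scaled into the unit ball; there the value of the difference of phi and a
    long partial sum depends on the i-th coefficient only, and it tends to 0.
    *)
Theorem schauder_criterion :
  schauder_basis (predual M) (predual_norm M) vector_functional.
Proof.
split; first exact: vector_functional_predual.
move=> phi pphi; exists (fun i => phi (mk_mem (MDi i))); split.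
  apply/cvgrPdist_le => e e0.
  have e0' : 0 < e%:C%C :> C by rewrite ltcR.
  have [N hN] := phi_remainder pphi e0'.
  exists N => // n /= le; rewrite sub0r normrN.
  have [|/andP[h1 h2] _] := @predual_norm_le
    (phi - \sum_(k < n) phi (mk_mem (MDi k)) *: vector_functional k) e.
    by move=> T T1; rewrite [X in `|X|](sub_sumE phi (fun k => phi (mk_mem (MDi k)))) ltW// hN.
  by rewrite ger0_norm.
move=> c hc; apply/funext => i.
have [b b0 hb] := M_bounded (MDi i).
(* One more than the bound, so as to divide by it when D i is zero. *)
have b1 : 0 < b + 1 by rewrite ltr_wpDl.
have MS : M (fun v => (b + 1)^-1 *: D i v + 0) by apply: MD.
pose S := mk_mem MS.
have S1 v : `|val S v| <= `|v|.
  rewrite /= addr0 normrZ gtr0_norm ?invr_gt0// mulrC ler_pdivrMr//.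
  by apply: le_trans (hb v) _; rewrite mulrC ler_wpM2l// lerDl.
have phiS : phi S = (b + 1)^-1 * phi (mk_mem (MDi i)).
  by rewrite /S (@phi_eq phi _ (mk_mem (MD (b + 1)^-1 (MDi i) M0)))// phiD// phi0// addr0.
have funcS k : vector_functional k S = (b + 1)^-1 * (k == i)%:R.
  by rewrite /vector_functional /= addr0 dotZl biorth.
have psiS n : (i < n)%N -> (phi - \sum_(k < n) c k *: vector_functional k) S =
    (b + 1)^-1 * (phi (mk_mem (MDi i)) - c i).
  move=> lt; rewrite sub_sumE phiS mulrBr; congr (_ - _).
  rewrite (bigD1 (Ordinal lt))//= funcS eqxx mulr1 mulrC big1 ?addr0// => k ki.
  rewrite funcS (_ : (k == i :> nat) = false) ?mulr0//.
  by apply: contraNF ki => /eqP e; apply/eqP/val_inj.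
have [N hN] := phi_remainder pphi (@ltr01 C).
have bnd n : exists e : R, forall T : set_type M, (forall v, `|val T v| <= `|v|) ->
    `|(phi - \sum_(k < n) c k *: vector_functional k) T| <= e%:C%C.
  pose X : C := 1 + \sum_(k < N) `|phi (mk_mem (MDi k))| * (`|u k| * `|w k|) +
    \sum_(k < n) `|c k| * (`|u k| * `|w k|).
  have X0 : 0 <= X.
    rewrite !addr_ge0 ?ler01// sumr_ge0// => k _; rewrite !mulr_ge0//.
  exists (complex.Re X) => T T1; rewrite RRe_real ?ger0_real// sub_sumE.
  have sumb m (a : nat -> C) : `|\sum_(k < m) a k * vector_functional k T| <=
      \sum_(k < m) `|a k| * (`|u k| * `|w k|).
    apply: le_trans (ler_norm_sum _ _ _) _; apply: ler_sum => k _.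
    by rewrite normrM ler_wpM2l// vector_functional_bound.
  apply: le_trans (ler_normB _ _) _; apply: lerD; last exact: sumb.
  rewrite -(subrK (\sum_(k < N) phi (mk_mem (MDi k)) * vector_functional k T) (phi T)).
  apply: le_trans (ler_normD _ _) _; apply: lerD.
    by rewrite ltW// hN.
  exact: (sumb N (fun k => phi (mk_mem (MDi k)))).
pose z := (b + 1)^-1 * (phi (mk_mem (MDi i)) - c i).
have z0 : complex.Re `|z| <= 0.
  apply/ler_addgt0Pl => e e0; rewrite addr0.
  have /cvgrPdist_le /(_ e e0)[N' _ hN'] := hc.
  pose n := maxn N' i.+1.
  have lt : (i < n)%N by rewrite leq_max leqnn orbT.
  have [e' he'] := bnd n; have [/andP[h1 _] h2] := predual_norm_le he'.
  rewrite /z -(psiS n lt); apply: le_trans (h2 S S1) _.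
  have := hN' n; rewrite /= sub0r normrN ger0_norm//; apply.
  by rewrite leq_maxl.
have : `|z| <= 0 by rewrite -Re_norm -[0 in X in _ <= X]/(0%:C%C) lecR.
rewrite normr_le0 /z mulf_eq0 invr_eq0 gt_eqF//= subr_eq0.
by move=> /eqP.
Qed.
End Criterion.
(** * The tensor product of the cyclic representation *)

Section Representation.
Variable K : numClosedFieldType.
Variables (A : cstarType K) (j : forall nu, 'M[K]_(2 ^ nu) -> A).
Arguments j : clear implicits.
Hypothesis limit_j : is_cstar_limit j.
Variable rho : A -> K.
Hypothesis rho_tracial : is_tracial_state rho.
Hypothesis rho_j : forall nu, (0 < nu)%N -> forall x, rho (j nu x) = ntrace x.
Variables (H : hilbertType K) (pi : A -> H -> H) (Omega : H).
Hypothesis gns : is_GNS rho pi Omega.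

Notation vH nu x := (pi (j nu x) Omega).

Lemma pi_linear x : linear (pi x).
Proof. by have [] := GNS_bounded gns x. Qed.

Lemma pi0 v : pi 0 v = 0.
Proof. exact: (linear_map0 (GNS_linear gns v)). Qed.

Lemma piZ a x v : pi (a *: x) v = a *: pi x v.
Proof. exact: (linear_mapZ (GNS_linear gns v)). Qed.

Lemma dot_pi a b : dot (pi a Omega) (pi b Omega) = rho (cmul (star b) a).
Proof. by rewrite -(GNS_star gns) -(GNS_state gns) (GNS_mul gns). Qed.

Lemma j_adj_mul nu (x y : 'M[K]_(2 ^ nu)) : (0 < nu)%N ->
  cmul (star (j nu y)) (j nu x) = j nu (adjmx y *m x).
Proof. by move=> nu0; rewrite -(limit_star limit_j)// (limit_mul limit_j). Qed.

Lemma dot_vH nu (x y : 'M[K]_(2 ^ nu)) : (0 < nu)%N ->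
  dot (vH nu x) (vH nu y) = hs x y.
Proof. by move=> nu0; rewrite dot_pi j_adj_mul// rho_j. Qed.

Lemma pi_vH nu (x y : 'M[K]_(2 ^ nu)) : (0 < nu)%N ->
  pi (j nu x) (vH nu y) = vH nu (x *m y).
Proof. by move=> nu0; rewrite (limit_mul limit_j)// (GNS_mul gns). Qed.

Lemma pi_cone v : pi cone v = v.
Proof.
have [C C0 lip] := bounded_op_lip (GNS_bounded gns cone).
apply: (@adh_eq K H H _ (pi cone) id C 1 v C0 ler01 lip) (dense_adh v (GNS_cyclic gns)).
  by move=> x y; rewrite mul1r.
move=> _ [x _ <-]; have := GNS_mul gns cone x.
by rewrite cmul1x => e; rewrite [in RHS]e.
Qed.

Lemma vec_one nu : (0 < nu)%N -> vH nu 1%:M = Omega.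
Proof. by move=> nu0; rewrite (limit_one limit_j)// pi_cone. Qed.

(** The embeddings of the levels into the limit are compatible, and the block
    norm does not change when the level is raised. *)
Lemma raise nu mu : (0 < nu <= mu)%N ->
  exists f : 'M[K]_(2 ^ nu) -> 'M[K]_(2 ^ mu), (forall x, j mu (f x) = j nu x) /\
   forall n (X : 'I_n -> 'I_n -> _) C, block_bound X C ->
     block_bound (fun d c => f (X d c)) C.
Proof.
move=> /andP[nu0]; elim: mu => [|mu IH]; first by case: (nu) nu0.
rewrite leq_eqVlt => /orP[/eqP <-|]; first by exists id.
rewrite ltnS => /[dup] le /IH[f [jf fb]]; exists (fun x => kron (f x) 1%:M); split.
  by move=> x; rewrite (limit_compat limit_j) ?jf// (leq_trans nu0).
by move=> n X C /fb; apply: block_bound_kron1.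
Qed.

Lemma pi_norm x : `|pi x Omega| <= `|x|.
Proof.
rewrite -(@ler_pXn2r _ 2) ?nnegrE// -dot_norm dot_pi -cstar_identity.
have := state_bounded rho_tracial (cmul (star x) x).
by rewrite ger0_norm//; apply: state_pos.
Qed.

Lemma vH_dense v : adh [set v | exists nu (x : 'M[K]_(2 ^ nu)), (0 < nu)%N /\ v = vH nu x] v.
Proof.
apply: adh_trans (dense_adh v (GNS_cyclic gns)) => _ [x _ <-].
apply: (@adh_map _ A H _ _ (fun x => pi x Omega) 1 x ler01 _ _
  (dense_adh x (limit_dense limit_j))).
  by apply: bounded_linear_lip; [exact: (GNS_linear gns)|move=> a; rewrite mul1r pi_norm].
by move=> _ [nu /= nu0 [x' _ <-]]; exists nu, x'.
Qed.

(** Right multiplication x Omega |-> x u Omega is isometric because rho is a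
    trace and u is unitary. It lies in the commutant of the representation,
    hence commutes with the factor that the representation generates. *)
Lemma right_mul nu (u : 'M[K]_(2 ^ nu)) : (0 < nu)%N -> u *m adjmx u = 1%:M ->
  exists R : H -> H, [/\ linear R, forall v, `|R v| <= 1 * `|v|,
   forall v w, dot (R v) (R w) = dot v w,
   commutant (range pi) R &
   forall y, R (vH nu y) = vH nu (y *m u)].
Proof.
move=> nu0 uu.
have [||R [Rl RB RD Rf]] := @extend_isometry K H H A (fun x => pi x Omega)
    (fun x => pi (cmul x (j nu u)) Omega).
- apply: dense_subset (GNS_cyclic gns) => v Sv.
  exists 1%N, (fun=> 1), (fun=> v); split => //.
  by rewrite big_ord1 scale1r.
- move=> a b; rewrite !dot_pi star_cmul -cmulA (state_trace rho_tracial).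
  rewrite -!cmulA -(limit_star limit_j)// -(limit_mul limit_j)// uu.
  by rewrite (limit_one limit_j)// cmulx1.
exists R; split => //; last first.
  by move=> y; rewrite Rf (limit_mul limit_j).
split; first by split => //; exists 1.
move=> _ [x _ <-]; apply/funext => v /=.
have [C C0 lip] := bounded_op_lip (GNS_bounded gns x).
have Rlip := bounded_linear_lip Rl RB.
apply: (@adh_eq K H H _ (R \o pi x) (pi x \o R) C C v C0 C0 _ _ _
  (dense_adh v (GNS_cyclic gns))) => [a b|a b|_ [a _ <-]] /=.
- by apply: le_trans (Rlip _ _) _; rewrite mul1r.
- apply: le_trans (lip _ _) _; rewrite ler_wpM2l//.
  by apply: le_trans (Rlip _ _) _; rewrite mul1r.
have e a' b' : pi a' (pi b' Omega) = pi (cmul a' b') Omega by rewrite (GNS_mul gns).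
by rewrite e !Rf e cmulA.
Qed.

Variables (L : hilbertType K) (delta : nat -> L).
Hypothesis delta_basis : is_orthonormal_basis delta.
Variables (HL : hilbertType K) (tens : H -> L -> HL).
Hypothesis tensor : is_hilbert_tensor tens.

Lemma norm_tens x y : `|tens x y| = `|x| * `|y|.
Proof.
apply/eqP; rewrite -(@eqrXn2 _ 2)// ?mulr_ge0//; apply/eqP.
by rewrite exprMn -!dot_norm (tens_dot tensor).
Qed.

Lemma norm_delta c : `|delta c| = 1.
Proof.
apply/eqP; rewrite -(@eqrXn2 _ 2)// ?ler01//; apply/eqP.
by rewrite -dot_norm (onb_dot delta_basis) eqxx expr1n.
Qed.

Lemma tens_sumr x (I : Type) (r : seq I) (P : pred I) F :
  tens x (\sum_(i <- r | P i) F i) = \sum_(i <- r | P i) tens x (F i).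
Proof. exact: (linear_map_sum (tens_linearr tensor x)). Qed.

Lemma tens_suml y (I : Type) (r : seq I) (P : pred I) F :
  tens (\sum_(i <- r | P i) F i) y = \sum_(i <- r | P i) tens (F i) y.
Proof. exact: (linear_map_sum (tens_linearl tensor y)). Qed.

Lemma tensZl a x y : tens (a *: x) y = a *: tens x y.
Proof. exact: (linear_mapZ (tens_linearl tensor y)). Qed.

Lemma tensZr a x y : tens x (a *: y) = a *: tens x y.
Proof. exact: (linear_mapZ (tens_linearr tensor x)). Qed.

Lemma tens_total_range :
  dense (span (range (fun p : H * L => tens p.1 p.2))).
Proof.
apply: dense_subset (tens_total tensor) => v [n [c [s [Ss ->]]]].
exists n, c, s; split => // i; have [x [y ->]] := Ss i.
by exists (x, y).
Qed.

(** This is the adjoint of x |-> x (x) delta_c. It is obtained by extension: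
    if w is the image of a combination v of simple tensors, then <w, w> = <v,
    w (x) delta_c>. *)
Lemma slice_ex c : exists S : HL -> H, [/\ linear S, forall v, `|S v| <= 1 * `|v| &
  forall p : H * L, S (tens p.1 p.2) = dot p.2 (delta c) *: p.1].
Proof.
apply: extend_span => [||r]; rewrite ?ler01//; first exact: tens_total_range.
set w := lincomb _ r; set u := lincomb _ r; rewrite mul1r.
have e : dot w w = dot u (tens w (delta c)).
  rewrite {1}/w /u !dot_suml; apply: eq_bigr => p _.
  by rewrite !dotZl (tens_dot tensor) [dot p.2.2 _ * _]mulrC.
have : `|w| ^+ 2 <= `|u| * `|w|.
  rewrite -dot_norm -[X in X <= _]ger0_norm ?e; last by rewrite -e dot_norm exprn_ge0.
  by apply: le_trans (cauchy_schwarz _ _) _; rewrite norm_tens norm_delta mulr1.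
have [->|w0] := eqVneq w 0; first by rewrite normr0.
by rewrite expr2 ler_pM2r// normr_gt0.
Qed.

Definition slice c : HL -> H := xget (fun=> 0) [set S : HL -> H |
  [/\ linear S, forall v, `|S v| <= 1 * `|v| &
  forall p : H * L, S (tens p.1 p.2) = dot p.2 (delta c) *: p.1]].

Lemma sliceP c : [/\ linear (slice c), forall v, `|slice c v| <= 1 * `|v| &
  forall p : H * L, slice c (tens p.1 p.2) = dot p.2 (delta c) *: p.1].
Proof. by have := xgetPex (fun=> 0) (slice_ex c). Qed.

Lemma slice_tens c x y : slice c (tens x y) = dot y (delta c) *: x.
Proof. by have [_ _ /(_ (x, y))] := sliceP c. Qed.

(** The operator pi x (x) e_dc, by [elem_optens]. *)
Definition elem x d c : HL -> HL := fun v => tens (pi x (slice c v)) (delta d).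

Lemma elem_bounded x d c : bounded_op (elem x d c).
Proof.
have [Sl SB _] := sliceP c; have [Pl [B PB]] := GNS_bounded gns x.
split; first by move=> a v w; rewrite /elem Sl Pl (tens_linearl tensor).
have [C C0 lip] := bounded_op_lip (GNS_bounded gns x).
exists C => v; rewrite norm_tens norm_delta mulr1.
have := lip (slice c v) 0; rewrite (linear_map0 Pl) !subr0 => /le_trans; apply.
by rewrite ler_wpM2l//; have := SB v; rewrite mul1r.
Qed.

Lemma elem_optens x d c : is_optens tens (pi x) (eop delta d.+1 c.+1) (elem x d c).
Proof.
split; first exact: elem_bounded.
move=> h l; rewrite /elem slice_tens (linear_mapZ (@pi_linear x)) tensZl.
by rewrite /eop /= tensZr.
Qed.

Lemma elem_delta x d c h c' :
  elem x d c (tens h (delta c')) = (c' == c)%:R *: tens (pi x h) (delta d).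
Proof.
by rewrite /elem slice_tens (onb_dot delta_basis) (linear_mapZ (@pi_linear x)) tensZl.
Qed.

Definition core_vec n nu (y : 'I_n -> 'M[K]_(2 ^ nu)) : HL :=
  \sum_c tens (vH nu (y c)) (delta c).

Lemma dot_core_vec n nu (y z : 'I_n -> 'M[K]_(2 ^ nu)) : (0 < nu)%N ->
  dot (core_vec y) (core_vec z) = \sum_c hs (y c) (z c).
Proof.
move=> nu0; rewrite dot_suml; apply: eq_bigr => c _; rewrite dot_sumr.
rewrite (bigD1 c)//= (tens_dot tensor) (onb_dot delta_basis) eqxx mulr1 dot_vH//.
rewrite big1 ?addr0// => d /negPf dc.
rewrite (tens_dot tensor) (onb_dot delta_basis).
by rewrite [_ == _ :> nat](_ : _ = (c == d)) // eq_sym dc mulr0.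
Qed.

(** The levels and the numbers of components are bounded below by N so that a
    core vector may be taken at least as large as a given block matrix. *)
Definition core_set N : set HL := [set v | exists nu n (y : 'I_n -> 'M[K]_(2 ^ nu)),
  [/\ (0 < nu)%N, (N <= nu)%N, (N <= n)%N & v = core_vec y]].

Lemma core_vec_widen n m nu mu (y : 'I_n -> 'M[K]_(2 ^ nu)) :
  (0 < nu <= mu)%N -> (n <= m)%N ->
  exists z : 'I_m -> 'M[K]_(2 ^ mu), core_vec z = core_vec y.
Proof.
move=> nm le; have [f [jf _]] := raise nm.
exists (fun c => if insub (val c) is Some i then f (y i) else 0).
pose F c : HL := if insub c is Some i then tens (vH nu (y i)) (delta c) else 0.
have nu0 : (0 < nu)%N by case/andP: nm.
have j0 : j mu 0 = 0.
  by apply: (linear_map0 (limit_linear limit_j _)); case/andP: nm => ? /(leq_trans _) ->.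
rewrite /core_vec; transitivity (\sum_(c < m) F c).
  apply: eq_bigr => c _; rewrite /F; case: insubP => [i _ e|_].
    by rewrite jf.
  by rewrite j0 pi0 (linear_map0 (tens_linearl tensor _)).
rewrite [RHS](_ : _ = \sum_(c < n) F c); last first.
  by apply: eq_bigr => c _; rewrite /F valK.
rewrite (big_ord_widen_cond m xpredT F le) [in RHS]big_mkcond /=.
apply: eq_bigr => c _; case: ifP => // /negbT; rewrite /F; case: insubP => //.
by move=> i ->.
Qed.

Lemma core_vecD a n nu (y z : 'I_n -> 'M[K]_(2 ^ nu)) : (0 < nu)%N ->
  a *: core_vec y + core_vec z = core_vec (fun c => a *: y c + z c).
Proof.
move=> nu0; rewrite /core_vec scaler_sumr -big_split; apply: eq_bigr => c _ /=.
rewrite (limit_linear limit_j)// (GNS_linear gns) (tens_linearl tensor).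
by [].
Qed.

Lemma core_linsub N : linsub (core_set N).
Proof.
split.
  exists (maxn 1 N), N, (fun=> 0); split; rewrite ?leq_maxr ?leq_max//.
  rewrite /core_vec big1// => c _.
  have nu0 : (0 < maxn 1 N)%N by rewrite leq_max.
  by rewrite (linear_map0 (limit_linear limit_j nu0)) pi0 (linear_map0 (tens_linearl tensor _)).
move=> a v w [nu [n [y [nu0 Nn Nn' ->]]]] [nu' [n' [y' [nu'0 N'n N'n' ->]]]].
have [||z <-] := @core_vec_widen _ (maxn n n') _ (maxn nu nu') y; rewrite ?leq_maxl ?nu0//.
have [||z' <-] := @core_vec_widen _ (maxn n n') _ (maxn nu nu') y'; rewrite ?leq_maxr ?nu'0//.
exists (maxn nu nu'), (maxn n n'), (fun c => a *: z c + z' c).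
by rewrite !leq_max nu0 Nn Nn' core_vecD// leq_max nu0.
Qed.

Lemma core_tens N nu (y : 'M[K]_(2 ^ nu)) c : (0 < nu)%N ->
  core_set N (tens (vH nu y) (delta c)).
Proof.
move=> nu0; (* The component c is the last one. *)
pose z (i : 'I_c.+1) := if i == ord_max then y else 0.
have j0 : j nu 0 = 0 by apply: (linear_map0 (limit_linear limit_j _)).
have -> : tens (vH nu y) (delta c) = core_vec z.
  rewrite /core_vec (bigD1 ord_max)//= /z eqxx big1 ?addr0// => i /negPf ->.
  by rewrite j0 pi0 (linear_map0 (tens_linearl tensor _)).
have [||z' <-] := @core_vec_widen _ (maxn c.+1 N) _ (maxn nu N) z; rewrite ?leq_maxl ?nu0//.
by exists (maxn nu N), (maxn c.+1 N), z'; rewrite !leq_max nu0 leqnn !orbT.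
Qed.

Lemma core_dense N v : adh (core_set N) v.
Proof.
have sE := core_linsub N.
apply: (@adh_span K HL _ (core_set N) v sE _ tens_total_range) => _ [[x l] _ <-] /=.
apply: (@adh_trans _ _ [set v | exists nu (y : 'M[K]_(2 ^ nu)),
    (0 < nu)%N /\ v = tens (vH nu y) l]); last first.
  apply: (@adh_map _ H HL _ _ (tens^~ l) `|l| x _ _ _ (vH_dense x)) => //.
    apply: bounded_linear_lip; first exact: (tens_linearl tensor).
    by move=> w; rewrite norm_tens mulrC.
  by move=> _ [nu [y [nu0 ->]]]; exists nu, y.
move=> _ [nu [y [nu0 ->]]].
have C0 : 0 <= `|vH nu y| by [].
apply: (@adh_map _ L HL _ _ (tens (vH nu y)) _ l C0 _ _
   (dense_adh l (onb_total delta_basis))).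
  apply: bounded_linear_lip; first exact: (tens_linearr tensor).
  by move=> w; rewrite norm_tens.
move=> _ [n [a [s [Ss ->]]]]; rewrite tens_sumr.
have -> : \sum_i tens (vH nu y) (a i *: s i) = \sum_i a i *: tens (vH nu y) (s i).
  by apply: eq_bigr => i _; rewrite tensZr.
by apply: linsub_sum => // i; have [c _ <-] := Ss i; apply: core_tens.
Qed.

Lemma bounded_op0 : bounded_op (fun _ : HL => 0 : HL).
Proof.
split; first by move=> a v w; rewrite scaler0 addr0.
by exists 0 => v; rewrite normr0 mul0r.
Qed.

Lemma bounded_opD (S T : HL -> HL) (a : K) : bounded_op S -> bounded_op T ->
  bounded_op (fun v => a *: S v + T v).
Proof.
move=> [Sl [B SB]] [Tl [C TC]]; split.
  move=> b v w; rewrite Sl Tl !scalerDr !scalerA addrACA [a * b]mulrC.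
  by rewrite -!scalerA.
exists (`|a| * B + C) => v; apply: le_trans (ler_normD _ _) _.
by rewrite mulrDl lerD// normrZ -mulrA ler_wpM2l.
Qed.

Lemma bounded_op_sum (I : Type) (r : seq I) (P : pred I) (F : I -> HL -> HL) :
  (forall i, bounded_op (F i)) -> bounded_op (fun v => \sum_(i <- r | P i) F i v).
Proof.
move=> Fb; elim: r => [|i r IH].
  by under eq_fun do rewrite big_nil; exact: bounded_op0.
under eq_fun do rewrite big_cons; case: (P i) => //.
by have := bounded_opD 1 (Fb i) IH; under eq_fun do rewrite scale1r.
Qed.

Definition block_op n nu (X : 'I_n -> 'I_n -> 'M[K]_(2 ^ nu)) : HL -> HL :=
  fun v => \sum_d \sum_c elem (j nu (X d c)) d c v.

Lemma block_op_bounded n nu (X : 'I_n -> 'I_n -> 'M[K]_(2 ^ nu)) :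
  bounded_op (block_op X).
Proof.
by apply: bounded_op_sum => d; apply: bounded_op_sum => c; apply: elem_bounded.
Qed.

Lemma slice_core_vec n nu (y : 'I_n -> 'M[K]_(2 ^ nu)) (c : 'I_n) :
  slice c (core_vec y) = vH nu (y c).
Proof.
have [Sl _ _] := sliceP c.
rewrite (linear_map_sum Sl) (bigD1 c)//= slice_tens (onb_dot delta_basis) eqxx scale1r.
rewrite big1 ?addr0// => d /negPf dc; rewrite slice_tens (onb_dot delta_basis).
by rewrite [_ == _ :> nat](_ : _ = (d == c)) // dc scale0r.
Qed.

(** On a core vector of a higher level, X acts as X (x) 1, which has the same
    block norm by [raise]; core vectors are dense. *)
Lemma block_op_bound n nu (X : 'I_n -> 'I_n -> 'M[K]_(2 ^ nu)) C B : (0 < nu)%N ->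
  block_bound X C -> (C <= B ^ 2)%N -> forall v, `|block_op X v| <= B%:R * `|v|.
Proof.
move=> nu0 XC CB v.
have [D D0 lip] := bounded_op_lip (block_op_bounded X).
apply: (@adh_le _ _ _ _ (block_op X) B%:R D v D0 _ lip _ (core_dense (maxn nu n) v)).
  by rewrite ler0n.
move=> _ [mu [m [y [mu0 le le' ->]]]].
rewrite -(@ler_pXn2r _ 2) ?nnegrE ?mulr_ge0 ?ler0n// exprMn -!dot_norm.
have le1 : (nu <= mu)%N by apply: leq_trans le; rewrite leq_maxl.
have le2 : (n <= m)%N by apply: leq_trans le'; rewrite leq_maxr.
have [f [jf fb]] := @raise nu mu (introT andP (conj nu0 le1)).
pose y' c := y (widen_ord le2 c).
have -> : block_op X (core_vec y) = core_vec (fun d => \sum_c f (X d c) *m y' c).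
  rewrite /block_op /core_vec; apply: eq_bigr => d _.
  have jl := limit_linear limit_j mu0.
  rewrite (linear_map_sum jl) (linear_map_sum (GNS_linear gns Omega)) tens_suml.
  apply: eq_bigr => c _; rewrite /elem -jf.
  by rewrite -[nat_of_ord c]/(nat_of_ord (widen_ord le2 c)) slice_core_vec pi_vH.
rewrite !dot_core_vec//; apply: le_trans (fb _ _ _ XC y') _.
apply: ler_pM; rewrite ?ler0n//.
- by rewrite sumr_ge0// => c _; apply: hs_ge0.
- by rewrite -natrX ler_nat.
pose F c := if insub c is Some i then hs (y i) (y i) else 0.
rewrite [X in X <= _](_ : _ = \sum_(c < n) F c); last first.
  apply: eq_bigr => c _; rewrite /F insubT ?(leq_trans (ltn_ord c))// => p.
  by congr hs; congr y; apply: val_inj.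
rewrite [X in _ <= X](_ : _ = \sum_(c < m) F c); last first.
  by apply: eq_bigr => c _; rewrite /F valK.
rewrite (big_ord_widen_cond m xpredT F le2) big_mkcond /=; apply: ler_sum => c _.
by case: ifP => // _; rewrite /F; case: insub => // i; rewrite hs_ge0.
Qed.

Lemma vN_generated_incl (V : hilbertType K) (S : set (V -> V)) T :
  bounded_op T -> S T -> vN_generated S T.
Proof. by move=> bT ST; split => // U [_ /(_ T ST)]. Qed.

Lemma eop_bounded a b : bounded_op (eop delta a b).
Proof.
split; first by move=> c x y; rewrite /eop dotDl dotZl scalerDl scalerA.
exists 1 => v; rewrite /eop normrZ norm_delta mulr1 mul1r.
by apply: le_trans (cauchy_schwarz _ _) _; rewrite norm_delta mulr1.
Qed.

Let M := vN_tensor tens (vN_generated (range pi)) (Bop L).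

Lemma elem_mem x d c : M (elem x d c).
Proof.
apply: vN_generated_incl; first exact: elem_bounded.
exists (pi x), (eop delta d.+1 c.+1); split; last exact: elem_optens.
  apply: vN_generated_incl; first exact: (GNS_bounded gns).
  by exists x.
exact: eop_bounded.
Qed.

Lemma mem_bounded T : M T -> bounded_op T. Proof. by case. Qed.

Lemma mem_linear T : M T -> linear T. Proof. by case=> -[]. Qed.

Lemma mem0 : M (fun=> 0).
Proof.
split; first exact: bounded_op0.
move=> U [[Ul _] _]; apply/funext => v /=.
by rewrite (linear_map0 Ul).
Qed.

Lemma memD a S T : M S -> M T -> M (fun v => a *: S v + T v).
Proof.
move=> [bS cS] [bT cT]; split; first exact: bounded_opD.
move=> U cU; apply/funext => v /=; have [[Ul _] _] := cU.
rewrite Ul; have /(congr1 (fun f => f v)) /= -> := cS U cU.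
by have /(congr1 (fun f => f v)) /= -> := cT U cU.
Qed.

Lemma mem_sum (I : Type) (r : seq I) (F : I -> HL -> HL) :
  (forall i, M (F i)) -> M (fun v => \sum_(i <- r) F i v).
Proof.
move=> Fm; elim: r => [|i r IH]; first by under eq_fun do rewrite big_nil; exact: mem0.
by under eq_fun do rewrite big_cons -[F i _]scale1r; apply: memD.
Qed.

(** T commutes with W = R (x) 1, R being the right multiplication by u; move W
    from one side of the inner product to the other. *)
Lemma mem_right_unitary T nu (u y : 'M[K]_(2 ^ nu)) l l' : M T -> (0 < nu)%N ->
  u *m adjmx u = 1%:M ->
  dot (T (tens (vH nu (y *m adjmx u)) l)) (tens Omega l') =
  dot (T (tens (vH nu y) l)) (tens (vH nu u) l').
Proof.
move=> MT nu0 uu; have [R [Rl RB RD Rc RvH]] := right_mul nu0 uu.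
have [||W [Wl WB WD Wt]] := @extend_isometry K HL HL _ (fun p : H * L => tens p.1 p.2)
    (fun p => tens (R p.1) p.2).
- exact: tens_total_range.
- by move=> p q; rewrite !(tens_dot tensor) RD.
have {}Wt x z : W (tens x z) = tens (R x) z by rewrite (Wt (x, z)).
have TW v : T (W v) = W (T v).
  have [_ /(_ W) h] := MT; suff /h/(congr1 (fun f => f v)) : commutant [set T | exists a b,
    [/\ vN_generated (range pi) a, Bop L b & is_optens tens a b T]] W by [].
  split; first by split => //; exists 1.
  move=> T0 [a [b [[_ /(_ R Rc) aR] _ [bT0 T0t]]]]; apply/funext => {}v /=.
  have [C C0 lip] := bounded_op_lip bT0.
  have Wlip := bounded_linear_lip Wl WB.
  have [T0l _] := bT0.
  apply: (@adh_eq K HL HL _ (W \o T0) (T0 \o W) C C v C0 C0 _ _ _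
    (dense_adh v tens_total_range)) => [x z|x z|_ [n [c [s [Ss ->]]]]] /=.
  - by apply: le_trans (Wlip _ _) _; rewrite mul1r.
  - apply: le_trans (lip _ _) _; rewrite ler_wpM2l//.
    by apply: le_trans (Wlip _ _) _; rewrite mul1r.
  rewrite !(linear_map_sum T0l, linear_map_sum Wl); apply: eq_bigr => i _.
  rewrite !(linear_mapZ T0l, linear_mapZ Wl); congr (_ *: _).
  have [[x z] _ <-] := Ss i; rewrite /= T0t !Wt T0t; congr tens.
  by have /(congr1 (fun f => f x)) := aR.
have uu' : adjmx u *m u = 1%:M by apply: mulmx1C.
have RO : R Omega = vH nu u by rewrite -[u]mul1mx -RvH vec_one.
by rewrite -WD -TW !Wt RvH -mulmxA uu' mulmx1 RO.
Qed.

(** Both sides are antilinear in w, and the unitary matrices span. *)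
Lemma mem_right T nu (w y : 'M[K]_(2 ^ nu)) l l' : M T -> (0 < nu)%N ->
  dot (T (tens (vH nu (y *m adjmx w)) l)) (tens Omega l') =
  dot (T (tens (vH nu y) l)) (tens (vH nu w) l').
Proof.
move=> MT nu0; have [n [c [u [uu ->]]]] := unitary_span w.
have jl := limit_linear limit_j nu0.
rewrite adjmx_sum mulmx_sumr !(linear_map_sum jl, linear_map_sum (GNS_linear gns Omega)).
rewrite !tens_suml (linear_map_sum (mem_linear MT)) dot_suml dot_sumr.
apply: eq_bigr => i _; rewrite adjmxZ -scalemxAr.
rewrite !(linear_mapZ jl) !piZ !tensZl (linear_mapZ (mem_linear MT)) dotZl dotZr.
by rewrite mem_right_unitary.
Qed.

(** With x = h_p, this is the functional of the tensor product of h_p with the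
    matrix unit of row c and column d, both counted from 0. *)
Definition coef (T : HL -> HL) d c (x : A) : K :=
  dot (T (tens (pi x Omega) (delta c))) (tens Omega (delta d)).

Lemma coef_linear T d c : M T -> scalar (coef T d c).
Proof.
move=> MT a x y; rewrite /coef (GNS_linear gns) (tens_linearl tensor).
by rewrite (mem_linear MT) dotDl dotZl.
Qed.

(** The d, c entry of T, projected to the level nu; it represents the
    functional coef T d c through the trace, by [ntrace_compress]. *)
Definition compress nu (T : HL -> HL) d c : 'M[K]_(2 ^ nu) :=
  \sum_(m < 4 ^ nu) (coef T d c (j nu (haar_basis K nu m)) /
      hs (haar_basis K nu m) (haar_basis K nu m))
    *: adjmx (haar_basis K nu m).

Lemma ntrace_compress_basis nu T d c m : (m < 4 ^ nu)%N ->
  ntrace (compress nu T d c *m haar_basis K nu m) = coef T d c (j nu (haar_basis K nu m)).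
Proof.
move=> mn; have [orth nz _] := haar_orth_basis K nu.
rewrite mulmx_suml ntrace_sum (bigD1 (Ordinal mn))//= -scalemxAl ntraceZ -/(hs _ _).
rewrite divfK ?nz// big1 ?addr0// => i im.
rewrite -scalemxAl ntraceZ -/(hs _ _) (orth m i) ?mulr0 //.
by apply: contraNneq im => e; apply/eqP/val_inj/esym.
Qed.

Lemma ntrace_compress nu T d c y : M T -> (0 < nu)%N ->
  ntrace (compress nu T d c *m y) = coef T d c (j nu y).
Proof.
move=> MT nu0; have [_ _ e] := haar_orth_basis K nu; rewrite (e y).
have jl := limit_linear limit_j nu0.
rewrite (linear_map_sum jl) mulmx_sumr ntrace_sum.
have cl : linear (coef T d c : A -> K^o) by apply: coef_linear.
rewrite (linear_map_sum cl); apply: eq_bigr => m _.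
by rewrite -scalemxAr ntraceZ (linear_mapZ jl) (linear_mapZ cl) ntrace_compress_basis.
Qed.

(** Let w be the image of y. By [mem_right], <w, w> is the coefficient of T
    between y and w seen as core vectors, hence it is at most the product of
    their norms. *)
Lemma compress_bound n nu T : M T -> (0 < nu)%N -> (forall v, `|T v| <= `|v|) ->
  block_bound (fun d c : 'I_n => compress nu T d c) 1.
Proof.
move=> MT nu0 T1 y; rewrite mul1r.
set w := fun d : 'I_n => \sum_(c < n) compress nu T d c *m y c.
have e : dot (core_vec w) (core_vec w) = dot (T (core_vec y)) (core_vec w).
  rewrite dot_core_vec// {2}/core_vec dot_sumr; apply: eq_bigr => d _.
  rewrite (linear_map_sum (mem_linear MT)) dot_suml {1}/w hs_suml.
  apply: eq_bigr => c _; rewrite -mem_right// -/(coef T d c _) -ntrace_compress//.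
  by rewrite /hs ntraceC !mulmxA.
rewrite -!dot_core_vec//.
have : `|core_vec w| ^+ 2 <= `|core_vec y| * `|core_vec w|.
  rewrite -dot_norm -[X in X <= _]ger0_norm ?dot_norm ?exprn_ge0// -dot_norm e.
  by apply: le_trans (cauchy_schwarz _ _) _; rewrite ler_wpM2r.
rewrite !dot_norm => h; rewrite ler_pXn2r ?nnegrE//.
have [->|w0] := eqVneq (core_vec w) 0; first by rewrite normr0.
by move: h; rewrite expr2 ler_pM2r// normr_gt0.
Qed.

Lemma haar_basis_level nu mu m : (0 < nu <= mu)%N -> (m < 4 ^ nu)%N ->
  j mu (haar_basis K mu m) = j nu (haar_basis K nu m).
Proof.
move=> /andP[nu0]; elim: mu => [|mu IH]; first by case: (nu) nu0.
rewrite leq_eqVlt => /orP[/eqP <- //|]; rewrite ltnS => le mn.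
have mu0 : (0 < mu)%N by apply: leq_trans le.
rewrite -(IH le mn) -(limit_compat limit_j mu0); congr j.
have -> : haar_basis K mu m = haar K mu m by rewrite /haar_basis (gtn_eqF mu0).
by apply: haar_incl => //; apply: leq_trans mn _; rewrite leq_exp2l.
Qed.

Definition haar_elt m : A := j m.+1 (haar_basis K m.+1 m).

Definition haar_sqnorm m : K := hs (haar_basis K m.+1 m) (haar_basis K m.+1 m).

(** The functional x |-> rho (cmul (haar_dual m) x) reads off the coefficient
    of h_m. *)
Definition haar_dual m : A := (haar_sqnorm m)^-1 *: star (haar_elt m).

Lemma ltn_pow4S m : (m < 4 ^ m.+1)%N.
Proof. by apply: ltn_trans (ltnSn m) _; apply: ltn_expl. Qed.

Lemma haar_elt_level nu m : (0 < nu)%N -> (m < 4 ^ nu)%N ->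
  haar_elt m = j nu (haar_basis K nu m).
Proof.
move=> nu0 mn; have /orP[le|le] := leq_total m.+1 nu.
  by apply/esym/haar_basis_level; rewrite ?ltn_pow4S.
by rewrite /haar_elt (@haar_basis_level nu m.+1)// nu0.
Qed.

Lemma haar_sqnorm_level nu m : (0 < nu)%N -> (m < 4 ^ nu)%N ->
  haar_sqnorm m = hs (haar_basis K nu m) (haar_basis K nu m).
Proof.
by move=> nu0 mn; rewrite /haar_sqnorm -(dot_vH _ _ (ltn0Sn m)) -[RHS]dot_vH//
  -(haar_elt_level nu0 mn).
Qed.

Lemma haar_dual_level nu m : (0 < nu)%N -> (m < 4 ^ nu)%N ->
  haar_dual m =
  j nu ((hs (haar_basis K nu m) (haar_basis K nu m))^-1 *: adjmx (haar_basis K nu m)).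
Proof.
move=> nu0 mn; rewrite (linear_mapZ (limit_linear limit_j nu0)) (limit_star limit_j)//.
by rewrite /haar_dual (haar_elt_level nu0 mn) (haar_sqnorm_level nu0 mn).
Qed.

Lemma elem0 d c v : elem 0 d c v = 0.
Proof. by rewrite /elem pi0 (linear_map0 (tens_linearl tensor _)). Qed.

Lemma elem_linear d c v : linear (fun x => elem x d c v).
Proof.
by move=> a x y; rewrite /elem (GNS_linear gns) (tens_linearl tensor).
Qed.

(** The indices a and b are counted from 0, so that they are also those of
    delta. *)
Definition box T P B' B v : HL :=
  \sum_(a < B') \sum_(b < B) \sum_(p < P) coef T b a (haar_elt p) *: elem (haar_dual p) b a v.

Lemma sum_elem nu P T d c v : (0 < nu)%N -> (P <= 4 ^ nu)%N ->
  \sum_(p < P) coef T d c (haar_elt p) *: elem (haar_dual p) d c v =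
  elem (j nu (dual_prefix (@haar_basis K nu) P (compress nu T d c))) d c v.
Proof.
move=> nu0 Pn.
have jl := limit_linear limit_j nu0.
rewrite (linear_map_sum jl) (linear_map_sum (elem_linear d c v)).
apply: eq_bigr => p _; have pn := leq_trans (ltn_ord p) Pn.
rewrite ntrace_compress_basis// -haar_elt_level// -scalerA (linear_mapZ jl).
by rewrite (linear_mapZ (elem_linear d c v)) -haar_dual_level.
Qed.

(** 148 is the constant of [block_bound_haar], and 148 <= 13 ^ 2. *)
Lemma box_bound T P B' B v : M T -> (forall v, `|T v| <= `|v|) ->
  `|box T P B' B v| <= 13%:R * `|v|.
Proof.
move=> MT T1; pose n := maxn B' B; pose nu := P.+1.
have Pn : (P <= 4 ^ nu)%N by apply/ltnW/ltn_pow4S.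
pose X (d c : 'I_n) := dual_prefix (@haar_basis K nu) P (compress nu T d c).
have XC : block_bound X (148 * 1).
  by apply: block_bound_haar => //; apply: compress_bound.
have YC := block_bound_mask (fun d : 'I_n => (d < B)%N) (fun c : 'I_n => (c < B')%N) XC.
have := @block_op_bound _ _ _ _ 13 (ltn0Sn P) YC isT v.
congr (`|_| <= _); rewrite /block_op exchange_big/= /box.
have j0 : j nu 0 = 0 by apply: (linear_map0 (limit_linear limit_j _)).
rewrite (big_ord_widen_cond n xpredT (fun a => \sum_(b < B) \sum_(p < P)
   coef T b a (haar_elt p) *: elem (haar_dual p) b a v) (leq_maxl _ _)) [RHS]big_mkcond /=.
apply: eq_bigr => c _; case: ifP => cB; last first.
  by rewrite big1// => d _; rewrite andbF j0 elem0.
rewrite (big_ord_widen_cond n xpredT (fun b => \sum_(p < P)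
   coef T b c (haar_elt p) *: elem (haar_dual p) b c v) (leq_maxr _ _)) [RHS]big_mkcond /=.
apply: eq_bigr => d _; rewrite andbT; case: ifP => dB; last by rewrite j0 elem0.
by rewrite (sum_elem _ _ _ _ (ltn0Sn P)).
Qed.

(** The functional with number i of the tensor product system. Its index
    starts from 0 while the shell enumerations start from 1, whence the
    shifts. *)
Definition coordinate T i : K := shell_enum (fun p q =>
  shell_enum (fun a b => coef T b.-1 a.-1 (haar_elt p.-1)) q) i.+1.

Definition dual_op i : HL -> HL := shell_enum (fun p q =>
  shell_enum (fun a b => elem (haar_dual p.-1) b.-1 a.-1) q) i.+1.

Definition left_vector i : HL := shell_enum (fun p q =>
  shell_enum (fun a _ => tens (pi (haar_elt p.-1) Omega) (delta a.-1)) q) i.+1.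

Definition right_vector i : HL := shell_enum (fun _ q =>
  shell_enum (fun _ b => tens Omega (delta b.-1)) q) i.+1.

Notation psum T n := (partial_sum left_vector right_vector dual_op T n).
Notation resid T n := (remainder left_vector right_vector dual_op T n).

(** Two uses of [shell_sum], each costing a factor 3. *)
Lemma partial_sum_norm T n v : M T -> (forall v, `|T v| <= `|v|) ->
  `|psum T n v| <= 117%:R * `|v|.
Proof.
move=> MT T1.
pose t p a b : HL := coef T b.-1 a.-1 (haar_elt p.-1) *: elem (haar_dual p.-1) b.-1 a.-1 v.
pose F p q := shell_enum (t p) q.
have three (x y z : HL) c : `|x| <= c * `|v| -> `|y| <= c * `|v| ->
    `|z| <= c * `|v| -> `|x + y - z| <= c * 3%:R * `|v|.
  move=> hx hy hz; apply: le_trans (ler_normB _ _) _.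
  apply: (@le_trans _ _ (c * `|v| + c * `|v| + c * `|v|)).
    by rewrite lerD// (le_trans (ler_normD _ _))// lerD.
  by rewrite le_eqVlt; apply/orP; left; apply/eqP; ring.
have Rb P Q : `|rect F P Q| <= 13%:R * 3%:R * `|v|.
  have -> : rect F P Q = \sum_(q < Q) shell_enum (fun a b => \sum_(p < P) t p.+1 a b) q.+1.
    by rewrite /rect exchange_big.
  have [B1 [B2 [B3 [B1' [B2' [B3' ->]]]]]] := shell_sum Q.
  by apply: three; apply: box_bound.
have [B1 [B2 [B3 [B1' [B2' [B3' e]]]]]] := shell_sum n.
rewrite (_ : psum T n v = \sum_(i < n) shell_enum F i.+1) // e.
rewrite (_ : 117%:R = 13%:R * 3%:R * 3%:R :> K); last by rewrite -!natrM.
exact: three.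
Qed.

Lemma coef_elem p p' a a' b b' :
  coef (elem (haar_dual p') b' a') b a (haar_elt p) =
  ((p == p') && (a == a') && (b == b'))%:R.
Proof.
rewrite /coef elem_delta dotZl (tens_dot tensor) (onb_dot delta_basis).
rewrite piZ dotZl (GNS_star gns) /=.
have [nu [nu0 pn pn']] : exists nu, [/\ 0 < nu, p < 4 ^ nu & p' < 4 ^ nu]%N.
  exists (maxn p p').+1; split => //; apply: leq_ltn_trans (ltn_pow4S _).
    exact: leq_maxl.
  exact: leq_maxr.
rewrite (haar_elt_level nu0 pn) (haar_elt_level nu0 pn') dot_vH// (haar_sqnorm_level nu0 pn').
have [orth nz _] := haar_orth_basis K nu; have [->|pp] := eqVneq p p'.
  rewrite mulVf; last exact: nz.
  by rewrite mul1r -natrM mulnb /= [b == _]eq_sym.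
by rewrite (orth p p')// mulr0 mul0r mulr0.
Qed.

Lemma coordinate_dual i k : coordinate (dual_op k) i = (i == k)%:R.
Proof.
rewrite /coordinate /dual_op /shell_enum coef_elem; congr (nat_of_bool _)%:R.
have [i1 i2 ie] := @unshellK i.+1 isT; have [k1 k2 ke] := @unshellK k.+1 isT.
have [] := unshellK i2; have [] := unshellK k2.
set a := (unshell (unshell i.+1).2).1; set b := (unshell (unshell i.+1).2).2.
set a' := (unshell (unshell k.+1).2).1; set b' := (unshell (unshell k.+1).2).2.
move=> a'0 b'0 qe' a0 b0 qe; apply/idP/eqP => [|ik]; last by rewrite /a /b /a' /b' ik !eqxx.
move=> /andP[/andP[/eqP pp /eqP aa] /eqP bb].
have {}pp : (unshell i.+1).1 = (unshell k.+1).1 by lia.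
have {}aa : a = a' by lia.
have {}bb : b = b' by lia.
by apply/eq_add_S; rewrite -ie -ke -qe -qe' aa bb pp.
Qed.

Lemma coefD a S T d c x : M S -> M T ->
  coef (fun v => a *: S v + T v) d c x = a * coef S d c x + coef T d c x.
Proof. by move=> MS MT; rewrite /coef dotDl dotZl. Qed.

Lemma coordinateD a S T i : M S -> M T ->
  coordinate (fun v => a *: S v + T v) i = a * coordinate S i + coordinate T i.
Proof. by move=> MS MT; rewrite /coordinate /shell_enum coefD. Qed.

Lemma dual_mem i : M (dual_op i).
Proof. exact: elem_mem. Qed.

Lemma partial_sum_mem T n : M (psum T n).
Proof. exact: (M_partial_sum _ _ mem0 memD dual_mem). Qed.

Lemma coordinate_psum T n i :
  coordinate (psum T n) i = if (i < n)%N then coordinate T i else 0.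
Proof.
elim: n => [|n IH].
  rewrite /coordinate /shell_enum /coef /partial_sum big_ord0 dot0l //.
have -> : psum T n.+1 = fun v => coordinate T n *: dual_op n v + psum T n v.
  by apply/funext => v; rewrite /partial_sum big_ord_recr addrC.
rewrite (coordinateD _ _ (dual_mem n) (partial_sum_mem T n)) IH coordinate_dual ltnS.
by case: ltngtP => [||->]; rewrite ?mulr0 ?add0r// mulr1 addr0.
Qed.

Lemma remainder_mem T n : M T -> M (resid T n).
Proof. by move=> MT; apply: memD => //; apply: partial_sum_mem. Qed.

Lemma remainder_norm T n v : M T -> (forall v, `|T v| <= `|v|) ->
  `|resid T n v| <= 118%:R * `|v|.
Proof.
move=> MT T1; rewrite /remainder scaleN1r addrC; apply: le_trans (ler_normB _ _) _.
rewrite (_ : 118%:R = 1 + 117%:R :> K); last by rewrite -natr1 addrC.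
by rewrite mulrDl mul1r lerD// partial_sum_norm.
Qed.

Lemma coordinate_resid T n i : M T -> (i < n)%N -> coordinate (resid T n) i = 0.
Proof.
move=> MT lt; rewrite /remainder coordinateD//; last exact: partial_sum_mem.
by rewrite coordinate_psum lt mulN1r addNr.
Qed.

(** The functional coef T d c on matrices of one level is a finite combination
    of coordinates, and a coordinate of the remainder vanishes from its index
    on. *)
Lemma coef_resid_level nu (y : 'M[K]_(2 ^ nu)) d c : (0 < nu)%N -> exists N, forall T n,
  M T -> (N <= n)%N -> coef (resid T n) d c (j nu y) = 0.
Proof.
move=> nu0; pose ix m := (shell m.+1 (shell c.+1 d.+1)).-1.
have s0 a b : (0 < a)%N -> (0 < b)%N -> (0 < shell a b)%N.
  by move=> a0 b0; have [h _] := shell_bounds a0 b0; apply: leq_trans h.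
have xc T m : coordinate T (ix m) = coef T d c (haar_elt m).
  by rewrite /coordinate /ix prednK ?s0 ?s0// /shell_enum shellK ?s0// shellK.
exists (\max_(m < 4 ^ nu) (ix m).+1) => T n MT Nn.
have [_ _ e] := haar_orth_basis K nu; rewrite (e y).
have jl := limit_linear limit_j nu0; rewrite (linear_map_sum jl).
have cl : linear (coef (resid T n) d c : A -> K^o).
  by apply: coef_linear; apply: remainder_mem.
rewrite (linear_map_sum cl) big1// => m _.
rewrite (linear_mapZ jl) (linear_mapZ cl) -haar_elt_level// -xc coordinate_resid ?scaler0//.
by apply: leq_trans Nn; apply: (@leq_bigmax _ (fun m : 'I_(4 ^ nu) => (ix m).+1)).
Qed.

Lemma core_resid u w : core_set 0 u -> core_set 0 w -> exists N, forall T n,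
  M T -> (N <= n)%N -> dot (resid T n u) w = 0.
Proof.
move=> [nu [n [y [nu0 _ _ ->]]]] [mu [m [z [mu0 _ _ ->]]]].
pose la := maxn nu mu; pose k := maxn n m.
have la0 : (0 < la)%N by rewrite leq_max nu0.
have [||y' <-] := @core_vec_widen _ k _ la y; rewrite ?leq_maxl ?nu0//.
have [||z' <-] := @core_vec_widen _ k _ la z; rewrite ?leq_maxr ?mu0//.
have /boolp.choice[N Nh] : forall p : 'I_k * 'I_k, exists N, forall T n, M T -> (N <= n)%N ->
    coef (resid T n) p.2 p.1 (j la (y' p.1 *m adjmx (z' p.2))) = 0.
  by move=> p; apply: coef_resid_level.
exists (\max_p N p) => T l MT Nl; have Mr := remainder_mem l MT.
rewrite (linear_map_sum (mem_linear Mr)) dot_suml big1// => c _.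
rewrite dot_sumr big1// => d _; rewrite -mem_right//.
rewrite -/(coef _ _ _ _) (Nh (c, d))//; apply: leq_trans Nl.
exact: (@leq_bigmax _ N (c, d)).
Qed.

End Representation.

(** * The Haar system tensored with the matrix units *)

Theorem corollary22 (R : realType)
    (A : cstarType R[i]) (j : forall nu, 'M[R[i]]_(2 ^ nu) -> A)
    (limit_j : is_cstar_limit j)
    (rho : A -> R[i]) (rho_tracial : is_tracial_state rho)
    (rho_j : forall nu, (0 < nu)%N -> forall x, rho (j nu x) = ntrace x)
    (H : hilbertType R[i]) (pi : A -> H -> H) (Omega : H)
    (gns : is_GNS rho pi Omega)
    (L : hilbertType R[i]) (delta : nat -> L)
    (delta_basis : is_orthonormal_basis delta)
    (HL : hilbertType R[i]) (tens : H -> L -> HL)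
    (tensor : is_hilbert_tensor tens) :
  let II1 := vN_generated (range pi) in
  let IIoo := vN_tensor tens II1 (Bop L) in
  let x := product_system tens (fun p => haar_op j pi p.-1) (eseq delta) in
  schauder_basis (predual IIoo) (predual_norm IIoo)
    (fun n => density_functional tens Omega delta IIoo (x n.+1)).
Proof.
move=> II1 IIoo x.
pose ix n := unshell (unshell n.+1).2.
pose u := left_vector j pi Omega delta tens.
pose w := right_vector Omega delta tens.
have xE : (fun n => density_functional tens Omega delta IIoo (x n.+1)) = vector_functional u w.
  apply/funext => n; apply/funext => T.
  have [p0 q0 _] := @unshellK n.+1 isT; have [a0 b0 _] := unshellK q0.
  rewrite -/(ix n) in a0 b0.
  have := elem_optens gns delta_basis tensor (haar_elt j (unshell n.+1).1.-1)
    (ix n).1.-1 (ix n).2.-1.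
  rewrite !prednK// => ot.
  have [_ xt] : is_optens tens (pi (haar_elt j (unshell n.+1).1.-1))
      (eop delta (ix n).1 (ix n).2) (x n.+1).
    exact: (@xgetPex _ (fun=> 0) _ (ex_intro _ _ ot)).
  have Tl : linear (val T) by apply: mem_linear (set_valP T).
  have z k : val T (x n.+1 (tens Omega (delta k))) =
      (k == (ix n).2.-1)%:R *: val T (u n).
    rewrite xt /eop (onb_dot delta_basis) (tensZr tensor).
    exact: (linear_mapZ Tl).
  rewrite /density_functional /tau (@lim_series_single _ _ (ix n).2.-1) => [|k /negPf kn] /=.
    by rewrite z eqxx scale1r.
  by rewrite z kn scale0r dot0l.
rewrite xE.
have nO : `|tens Omega (delta 0)| = 1.
  apply/eqP; rewrite -(@eqrXn2 _ 2)// ?ler01//; apply/eqP.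
  rewrite -dot_norm (tens_dot tensor) (onb_dot delta_basis) eqxx mulr1 expr1n.
  by rewrite -{1}(pi_cone gns Omega) (GNS_state gns) (state_one rho_tracial).
apply: (@schauder_criterion R HL IIoo _ _ _ _ u w (dual_op j pi delta tens) _ 118%:R nO).
- by move=> T; apply: mem_linear.
- move=> T MT; have [C C0 lip] := bounded_op_lip (mem_bounded MT).
  by exists C => // v; have := lip v 0; rewrite (linear_map0 (mem_linear MT)) !subr0.
- exact: mem0.
- by move=> a S T; apply: memD.
- exact: (dual_mem j gns delta_basis tensor).
- by move=> i k; apply: (coordinate_dual limit_j rho_j gns delta_basis tensor).
- by rewrite ler0n.
- by move=> T n v; apply: (remainder_norm limit_j rho_tracial rho_j gns delta_basis tensor).
- exact: (core_dense limit_j rho_tracial gns delta_basis tensor 0).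
- by move=> a b; apply: (core_resid limit_j rho_tracial rho_j gns delta_basis tensor).
Qed.
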